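(* Let $\kappa$ be the first unfoldable cardinal, and $\theta$ be the first Ramsey cardinal. Then $\kappa<\theta$.
   Context: $\mathcal{R}(\kappa)=V_\kappa$ is the set of all sets of rank less than $\kappa$. For structures $\mathfrak{A}=(M,E,\dots)$ and $\mathfrak{B}=(N,F,\dots)$ in the same language, $\mathfrak{B}$ is an end elementary extension (eee) of $\mathfrak{A}$, written $\mathfrak{A}\prec_e\mathfrak{B}$, if $\mathfrak{B}$ is a proper elementary extension of $\mathfrak{A}$ and for every $a\in M$, $\{b\in M : bEa\}=\{b\in N: bFa\}$. $o(M)$ denotes the ordinal height of $M$. A cardinal $\kappa$ is unfoldable if it is inaccessible and for every ordinal $\alpha$ and every $S\subset\mathcal{R}(\kappa)$ there is a well-founded eee $M$ of $(\mathcal{R}(\kappa),\in,S)$ with $o(M)\geq\alpha$. *)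

(* Defs.v *)
From Stdlib Require Import Ensembles Finite_sets ClassicalEpsilon.
From Stdlib Require Import FunctionalExtensionality PropExtensionality.

(** Sets are Aczel's well-founded trees over a universe of types, modulo
    extensional equality.  With classical logic and choice this is a model of
    ZFC, with full second-order separation and replacement: every subclass
    [V -> Prop] of a set is a set, and every [V -> V] restricted to a set is the
    action of a set function.  So subclasses of sets and meta-level maps are used
    below where set theory would have coded subsets and functions. *)
Inductive tree : Type := node (A : Type) (f : A -> tree).

Fixpoint teq (s t : tree) : Prop :=
  match s, t with
  | node A f, node J g =>
      (forall i, exists j, teq (f i) (g j)) /\
      (forall j, exists i, teq (f i) (g j))
  end.

Definition tmem (s t : tree) : Prop :=
  match t with node J g => exists j, teq s (g j) end.

(** Working with classes makes equality of sets Leibniz equality. *)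
Definition V : Type := {C : tree -> Prop | exists t, C = teq t}.

Definition cls (t : tree) : V := exist _ (teq t) (ex_intro _ t eq_refl).

Definition mem (x y : V) : Prop :=
  exists s t, x = cls s /\ y = cls t /\ tmem s t.

Declare Scope set_scope.
Open Scope set_scope.
Notation "x ∈ y" := (mem x y) (at level 70, no associativity) : set_scope.
Notation "x ∉ y" := (~ mem x y) (at level 70, no associativity) : set_scope.

Definition subset (x y : V) : Prop := forall z, z ∈ x -> z ∈ y.
Notation "x ⊆ y" := (subset x y) (at level 70, no associativity) : set_scope.

(** [setof P] is only meaningful when [P] is the class of elements of a set. *)
Definition setof (P : V -> Prop) : V :=
  epsilon (inhabits (cls (node False (False_rect tree))))
          (fun a => forall x, x ∈ a <-> P x).

Lemma teq_refl s : teq s s.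
Proof. induction s as [A f IH]; simpl; split; intros i; exists i; apply IH. Qed.

Lemma teq_sym s t : teq s t -> teq t s.
Proof.
  revert t; induction s as [A f IH]; intros [J g]; simpl; intros [H1 H2].
  split; [intros j; destruct (H2 j) as [i Hi]
         |intros i; destruct (H1 i) as [j Hj]]; eauto.
Qed.

Lemma teq_trans s t u : teq s t -> teq t u -> teq s u.
Proof.
  revert t u; induction s as [A f IH]; intros [J g] [K h]; simpl.
  intros [H1 H2] [H3 H4]; split.
  - intros i; destruct (H1 i) as [j Hj]; destruct (H3 j) as [k Hk]; eauto.
  - intros k; destruct (H4 k) as [j Hj]; destruct (H2 j) as [i Hi]; eauto.
Qed.

Lemma cls_eq s t : cls s = cls t <-> teq s t.
Proof.
  split.
  - intros H; apply (f_equal (@proj1_sig _ _)) in H; simpl in H.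
    rewrite H; apply teq_refl.
  - intros H; unfold cls.
    assert (E : teq s = teq t).
    { apply functional_extensionality; intros u; apply propositional_extensionality.
      split; intros Hu; eauto using teq_trans, teq_sym. }
    apply eq_sig_hprop; [intros; apply proof_irrelevance|exact E].
Qed.

Lemma cls_surj (x : V) : exists t, x = cls t.
Proof.
  destruct x as [C [t ->]]; exists t; unfold cls.
  apply eq_sig_hprop; [intros; apply proof_irrelevance|reflexivity].
Qed.

Lemma mem_node (x : V) (A : Type) (f : A -> tree) :
  x ∈ cls (node A f) <-> exists i, x = cls (f i).
Proof.
  split.
  - intros (s & [J g] & -> & Ht & j & Hj).
    apply cls_eq in Ht; destruct Ht as [_ H2]; destruct (H2 j) as [i Hi].
    exists i; apply cls_eq; eauto using teq_trans, teq_sym.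
  - intros [i ->]; exists (f i), (node A f); repeat split.
    exists i; apply teq_refl.
Qed.

Lemma set_ext (x y : V) : (forall z, z ∈ x <-> z ∈ y) -> x = y.
Proof.
  destruct (cls_surj x) as [[A f] ->], (cls_surj y) as [[J g] ->]; intros H.
  apply cls_eq; split.
  - intros i; assert (Hi : cls (f i) ∈ cls (node J g)).
    { apply H, mem_node; eauto. }
    apply mem_node in Hi; destruct Hi as [j Hj]; exists j; now apply cls_eq.
  - intros j; assert (Hj : cls (g j) ∈ cls (node A f)).
    { apply H, mem_node; eauto. }
    apply mem_node in Hj; destruct Hj as [i Hi]; exists i; now apply cls_eq.
Qed.

Lemma mem_wf : well_founded mem.
Proof.
  intros x; destruct (cls_surj x) as [t ->].
  induction t as [A f IH]; constructor; intros y Hy.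
  apply mem_node in Hy; destruct Hy as [i ->]; apply IH.
Qed.

Definition is_set (P : V -> Prop) : Prop := exists a, forall x, x ∈ a <-> P x.

Lemma mem_setof P : is_set P -> forall x, x ∈ setof P <-> P x.
Proof. apply (epsilon_spec _ (fun a => forall x, x ∈ a <-> P x)). Qed.

Lemma set_enum (a : V) :
  exists (A : Type) (F : A -> tree), forall x, x ∈ a <-> exists i, x = cls (F i).
Proof.
  destruct (cls_surj a) as [[A f] ->]; exists A, f; intros x; apply mem_node.
Qed.

Lemma is_set_sub (P : V -> Prop) (a : V) : (forall x, P x -> x ∈ a) -> is_set P.
Proof.
  intros H; destruct (set_enum a) as (A & F & HF).
  exists (cls (node {i : A | P (cls (F i))} (fun i => F (proj1_sig i)))).
  intros x; rewrite mem_node; split.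
  - intros [[i Hi] ->]; exact Hi.
  - intros Hx; destruct (proj1 (HF x) (H x Hx)) as [i ->].
    now exists (exist _ i Hx).
Qed.

Lemma is_set_bigcup (a : V) (Q : V -> V -> Prop) :
  (forall y, y ∈ a -> is_set (Q y)) -> is_set (fun x => exists2 y, y ∈ a & Q y x).
Proof.
  intros H; destruct (set_enum a) as (A & F & HF).
  assert (HG : forall i, exists t, forall x, x ∈ cls t <-> Q (cls (F i)) x).
  { intros i; destruct (H (cls (F i))) as [b Hb]; [apply HF; eauto|].
    destruct (cls_surj b) as [t ->]; eauto. }
  pose (G i := proj1_sig (constructive_indefinite_description _ (HG i))).
  assert (GP : forall i x, x ∈ cls (G i) <-> Q (cls (F i)) x).
  { intros i; exact (proj2_sig (constructive_indefinite_description _ (HG i))). }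
  pose (idx t := match t with node J _ => J end).
  pose (sub t := match t return idx t -> tree with node _ g => g end).
  assert (HS : forall t x, x ∈ cls t <-> exists j, x = cls (sub t j)).
  { intros [J g] x; apply mem_node. }
  exists (cls (node {i : A & idx (G i)} (fun p => sub (G (projT1 p)) (projT2 p)))).
  intros x; rewrite mem_node; split.
  - intros [[i j] ->]; exists (cls (F i)); [apply HF; eauto|].
    apply GP, HS; simpl; eauto.
  - intros [y Hy Hx]; apply HF in Hy; destruct Hy as [i ->].
    apply GP, HS in Hx; destruct Hx as [j ->]; now exists (existT _ i j).
Qed.

Lemma is_set_power (a : V) : is_set (fun x => x ⊆ a).
Proof.
  destruct (set_enum a) as (A & F & HF).
  exists (cls (node (A -> Prop) (fun P => node {i | P i} (fun i => F (proj1_sig i))))).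
  intros x; rewrite mem_node; split.
  - intros [P ->] z Hz; apply mem_node in Hz; destruct Hz as [[i Hi] ->].
    apply HF; eauto.
  - intros Hx; exists (fun i => cls (F i) ∈ x); apply set_ext; intros z.
    rewrite mem_node; split.
    + intros Hz; destruct (proj1 (HF z) (Hx z Hz)) as [i ->].
      now exists (exist _ i Hz).
    + intros [[i Hi] ->]; exact Hi.
Qed.

Definition transitive (x : V) : Prop := forall y, y ∈ x -> y ⊆ x.

Definition ordinal (x : V) : Prop :=
  transitive x /\ forall y, y ∈ x -> transitive y.

(** [rank x] is the supremum of the successors of the [rank y], [y ∈ x]. *)
Definition rank : V -> V :=
  Fix mem_wf (fun _ => V) (fun x rec =>
    setof (fun z => exists y (H : y ∈ x), z ∈ rec y H \/ z = rec y H)).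

Definition R (κ : V) : V := setof (fun x => rank x ∈ κ).

Lemma is_set_succ (a : V) : is_set (fun z => z ∈ a \/ z = a).
Proof.
  destruct (is_set_power a) as [p Hp].
  destruct (cls_surj a) as [[A f] Ha].
  exists (cls (node (option A) (fun o =>
    match o with Some i => f i | None => node A f end))).
  intros z; rewrite mem_node, Ha, mem_node; split.
  - intros [[i|] ->]; eauto.
  - intros [[i ->]| ->]; [now exists (Some i)|now exists None].
Qed.

Lemma mem_rank (x z : V) :
  z ∈ rank x <-> exists2 y, y ∈ x & z ∈ rank y \/ z = rank y.
Proof.
  unfold rank at 1; rewrite Fix_eq.
  2:{ intros u f g Hfg; f_equal; apply functional_extensionality; intros w.
      apply propositional_extensionality; split; intros (y & H & Hy);
      exists y, H; [rewrite <- Hfg|rewrite Hfg]; exact Hy. }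
  fold rank; rewrite mem_setof.
  - split; [intros (y & H & Hz)|intros [y H Hz]]; eauto.
  - destruct (is_set_bigcup x (fun y z => z ∈ rank y \/ z = rank y)) as [b Hb].
    + intros; apply is_set_succ.
    + exists b; intros w; rewrite Hb.
      split; [intros [y H Hw]|intros (y & H & Hw)]; eauto.
Qed.

Lemma mem_R (κ x : V) : x ∈ R κ <-> rank x ∈ κ.
Proof.
  apply (mem_setof (fun x => rank x ∈ κ)); clear x.
  induction κ as [κ IH] using (well_founded_ind mem_wf).
  destruct (is_set_bigcup κ (fun β x => rank x = β)) as [b Hb].
  - intros β Hβ; destruct (IH β Hβ) as [r Hr].
    destruct (is_set_power r) as [p Hp].
    apply (is_set_sub _ p); intros x Hx; apply Hp; intros y Hy.
    apply Hr; rewrite <- Hx; apply mem_rank; eauto.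
  - exists b; intros x; rewrite Hb; split.
    + intros [β Hβ <-]; exact Hβ.
    + intros H; eauto.
Qed.

Definition elts (a : V) : Ensemble V := fun x => x ∈ a.

Definition injects {T : Type} (A : Ensemble V) (B : Ensemble T) : Prop :=
  exists f : V -> T, (forall x, A x -> B (f x)) /\
    (forall x y, A x -> A y -> f x = f y -> x = y).

Definition equipotent (A B : Ensemble V) : Prop :=
  exists f : V -> V, (forall x, A x -> B (f x)) /\
    (forall x y, A x -> A y -> f x = f y -> x = y) /\
    (forall y, B y -> exists2 x, A x & f x = y).

Definition is_cardinal (κ : V) : Prop :=
  ordinal κ /\ forall β, β ∈ κ -> ~ equipotent (elts κ) (elts β).

Definition infinite (a : V) : Prop := ~ Finite V (elts a).

Definition uncountable (a : V) : Prop := ~ injects (elts a) (Full_set nat).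

Definition regular (κ : V) : Prop :=
  forall β (f : V -> V), β ∈ κ -> (forall ξ, ξ ∈ β -> f ξ ∈ κ) ->
  exists2 γ, γ ∈ κ & forall ξ, ξ ∈ β -> f ξ ∈ γ.

(** Equipotence with some [γ < κ] says [2 ^ β < κ] because [κ] is a cardinal. *)
Definition strong_limit (κ : V) : Prop :=
  forall β, β ∈ κ ->
  exists2 γ, γ ∈ κ & equipotent (fun x => x ⊆ β) (elts γ).

Definition inaccessible (κ : V) : Prop :=
  is_cardinal κ /\ uncountable κ /\ regular κ /\ strong_limit κ.

(** [κ → (κ)^{<ω}_2]: the colour of a homogeneous finite set may depend on its
    size.  Only the values of [f] at finite subsets of [κ] matter. *)
Definition ramsey (κ : V) : Prop :=
  is_cardinal κ /\ infinite κ /\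
  forall f : V -> bool,
  exists H, H ⊆ κ /\ equipotent (elts H) (elts κ) /\
    forall n s t, s ⊆ H -> t ⊆ H ->
      cardinal V (elts s) n -> cardinal V (elts t) n -> f s = f t.

(** The language has one binary and one unary relation symbol, for [(R κ, ∈, S)].
    The carrier is a set; the relations matter only on it. *)
Record structure := Structure {
  dom : V;
  rel : V -> V -> Prop;
  prd : V -> Prop
}.

(** De Bruijn indices: [fAll] binds index [0]. *)
Inductive formula : Type :=
| fRel (i j : nat)
| fEq (i j : nat)
| fPrd (i : nat)
| fNot (φ : formula)
| fAnd (φ ψ : formula)
| fAll (φ : formula).

Definition scons (x : V) (v : nat -> V) (n : nat) : V :=
  match n with O => x | S m => v m end.

Fixpoint sat (A : structure) (φ : formula) (v : nat -> V) : Prop :=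
  match φ with
  | fRel i j => rel A (v i) (v j)
  | fEq i j => v i = v j
  | fPrd i => prd A (v i)
  | fNot φ => ~ sat A φ v
  | fAnd φ ψ => sat A φ v /\ sat A ψ v
  | fAll φ => forall x, x ∈ dom A -> sat A φ (scons x v)
  end.

Definition elementary_extension (A B : structure) : Prop :=
  dom A ⊆ dom B /\
  forall φ v, (forall n, v n ∈ dom A) -> (sat A φ v <-> sat B φ v).

Definition end_elementary_extension (A B : structure) : Prop :=
  elementary_extension A B /\ dom A <> dom B /\
  forall a, a ∈ dom A ->
    forall b, (b ∈ dom A /\ rel A b a) <-> (b ∈ dom B /\ rel B b a).

Definition wellfounded_structure (A : structure) : Prop :=
  well_founded (fun x y => x ∈ dom A /\ y ∈ dom A /\ rel A x y).

(** [ordinal_in A x]: the formula defining [ordinal] holds of [x] in [A].  The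
    height of a well-founded [A] is the order type of these elements. *)
Definition transitive_in (A : structure) (x : V) : Prop :=
  forall y z, y ∈ dom A -> z ∈ dom A -> rel A y x -> rel A z y -> rel A z x.

Definition ordinal_in (A : structure) (x : V) : Prop :=
  x ∈ dom A /\ transitive_in A x /\
  forall y, y ∈ dom A -> rel A y x -> transitive_in A y.

Definition ordinal_height (A : structure) (β : V) : Prop :=
  ordinal β /\
  exists f : V -> V,
    (forall x, ordinal_in A x -> f x ∈ β) /\
    (forall y, y ∈ β -> exists2 x, ordinal_in A x & f x = y) /\
    (forall x y, ordinal_in A x -> ordinal_in A y -> f x = f y -> x = y) /\
    (forall x y, ordinal_in A x -> ordinal_in A y -> (rel A x y <-> f x ∈ f y)).

Definition unfoldable (κ : V) : Prop :=
  inaccessible κ /\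
  forall α S, ordinal α -> S ⊆ R κ ->
  exists M : structure,
    wellfounded_structure M /\
    end_elementary_extension (Structure (R κ) mem (elts S)) M /\
    exists2 β, ordinal_height M β & α ⊆ β.

Definition first (P : V -> Prop) (κ : V) : Prop :=
  P κ /\ forall μ, μ ∈ κ -> ~ P μ.

(* Main.v *)
From Stdlib Require Import Ensembles Finite_sets ClassicalEpsilon Classical.
From Stdlib Require Import FunctionalExtensionality PropExtensionality.
From Stdlib Require Import List Sorting.Sorted Lia Cantor.
Require Import Defs.
Import ListNotations.

(** Suppose that [κ] is not below the Ramsey cardinal [θ].  Then no [μ < θ] is
    unfoldable: every inaccessible [μ < θ] has some [Sq μ ⊆ R μ] and an ordinal
    [α μ] such that no well-founded end elementary extension of
    [(R μ, ∈, Sq μ)] has height at least [α μ].  Such an extension is found,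
    for a suitable [μ = γ], in two steps.

    The first step ([ramsey_reflection]) is [(R γ, ∈, Sq γ) ≺ (R θ, ∈, S)] for
    some inaccessible [γ < θ] and some [S].  It rests on the almost ineffability
    of [θ] ([coherent_subsequence]): given a predicate [T γ] on sets of rank
    below [γ], for each [γ < θ], there are [θ] many [γ] at which these predicates
    are restrictions of one another.  Here [T γ] is the elementary diagram of
    [(R γ, ∈, Sq γ)], together with a witness that [γ] is not inaccessible, if
    there is one; coherence rules such witnesses out.  Almost ineffability is
    proved by an infinite descent: on a homogeneous set where coherence fails,
    the places of first failure form a homogeneous set of smaller ordinals.

    The second step ([ramsey_extension]) extends [(R θ, ∈, S)] itself, by the
    construction of Ehrenfeucht and Mostowski.  There is a set [H] of [θ]
    indiscernibles, even over parameters from any [R c] with [c] below the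
    indiscernibles considered ([indiscernibles]).  The elements of the extension
    are Skolem terms in constants from [R θ] and in indices from an arbitrarily
    long well-order.  A term is a function of the assignment of elements of [H]
    to the indices, so that the extension is a kind of ultrapower: a formula
    holds of terms if it holds for almost all assignments, those that are
    increasing on countably many indices and large enough.  Indiscernibility
    decides each formula, which gives the theorem of Łoś ([los]); it makes terms
    with values in a given set almost constant ([value_regressive]), so that the
    extension is an end extension; countable completeness makes it well-founded;
    and the indices are ordinals that make it high.

    Both steps use that [θ] is regular and a strong limit; this is proved from
    colourings of pairs and triples ([ramsey_regular], [small_power]). *)

(** * Ordinals *)

Lemma mem_min (P : V -> Prop) x : P x -> exists y, P y /\ forall z, z ∈ y -> ~ P z.
Proof.
  induction x as [x IH] using (well_founded_ind mem_wf); intros Hx.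
  destruct (classic (exists z, z ∈ x /\ P z)) as [(z & Hz & Pz)|N]; eauto.
  exists x; split; auto; intros z Hz Pz; apply N; eauto.
Qed.

Lemma mem_irrefl x : x ∉ x.
Proof. induction x as [x IH] using (well_founded_ind mem_wf); intros H; exact (IH x H H). Qed.

Lemma mem_asym x y : x ∈ y -> y ∉ x.
Proof.
  revert y; induction x as [x IH] using (well_founded_ind mem_wf); intros y H H'.
  exact (IH y H' x H' H).
Qed.

Lemma ordinal_mem a b : ordinal a -> b ∈ a -> ordinal b.
Proof.
  intros [Ht He] Hb; split; [now apply He|].
  intros y Hy; apply He, (Ht b); auto.
Qed.

Lemma ordinal_trans a b c : ordinal c -> a ∈ b -> b ∈ c -> a ∈ c.
Proof. intros [Ht _] Ha Hb; exact (Ht b Hb a Ha). Qed.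

Lemma ordinal_trichotomy a b : ordinal a -> ordinal b -> a ∈ b \/ a = b \/ b ∈ a.
Proof.
  revert b; induction a as [a IHa] using (well_founded_ind mem_wf); intros b Oa.
  induction b as [b IHb] using (well_founded_ind mem_wf); intros Ob.
  destruct (classic (a ∈ b)) as [H|Nab]; auto.
  destruct (classic (b ∈ a)) as [H|Nba]; auto.
  right; left; apply set_ext; intros z; split; intros Hz.
  - destruct (IHa z Hz b (ordinal_mem _ _ Oa Hz) Ob) as [H|[->|H]]; auto; try easy.
    destruct (Nba (ordinal_trans _ _ _ Oa H Hz)).
  - destruct (IHb z Hz (ordinal_mem _ _ Ob Hz)) as [H|[->|H]]; auto; try easy.
    destruct (Nab (ordinal_trans _ _ _ Ob H Hz)).
Qed.

Lemma ordinal_not_mem a b : ordinal a -> ordinal b -> a ∉ b -> a = b \/ b ∈ a.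
Proof. intros Oa Ob N; destruct (ordinal_trichotomy a b Oa Ob) as [H|H]; [easy|exact H]. Qed.

Lemma ordinal_subset a b : ordinal a -> ordinal b -> a ⊆ b -> a = b \/ a ∈ b.
Proof.
  intros Oa Ob Hs; destruct (ordinal_trichotomy a b Oa Ob) as [H|[H|H]]; auto.
  destruct (mem_irrefl b (Hs b H)).
Qed.

Lemma ordinal_mem_not_mem a b c : ordinal a -> ordinal b -> b ∉ a -> c ∈ a -> c ∈ b.
Proof.
  intros Oa Ob N Hc; destruct (ordinal_not_mem b a Ob Oa N) as [->|H]; auto.
  exact (ordinal_trans _ _ _ Ob Hc H).
Qed.

Definition succ (a : V) : V := setof (fun z => z ∈ a \/ z = a).

Lemma mem_succ a z : z ∈ succ a <-> z ∈ a \/ z = a.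
Proof. apply (mem_setof (fun z => z ∈ a \/ z = a)), is_set_succ. Qed.

Lemma ordinal_succ a : ordinal a -> ordinal (succ a).
Proof.
  intros Oa; split.
  - intros y Hy z Hz; apply mem_succ; left; apply mem_succ in Hy as [Hy| ->]; auto.
    exact (ordinal_trans _ _ _ Oa Hz Hy).
  - destruct Oa as [Ht He]; intros y Hy; apply mem_succ in Hy as [Hy| ->]; auto.
Qed.

Lemma ordinal_of_mems a : transitive a -> (forall x, x ∈ a -> ordinal x) -> ordinal a.
Proof. intros Ht Ho; split; [exact Ht|intros y Hy; apply Ho, Hy]. Qed.

Lemma ordinal_rank x : ordinal (rank x).
Proof.
  induction x as [x IH] using (well_founded_ind mem_wf).
  apply ordinal_of_mems.
  - intros y Hy z Hz; apply mem_rank in Hy as [w Hw Hy]; apply mem_rank.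
    exists w; auto; left; destruct Hy as [Hy| ->]; auto.
    exact (ordinal_trans _ _ _ (IH w Hw) Hz Hy).
  - intros y Hy; apply mem_rank in Hy as [w Hw [Hy| ->]]; auto.
    exact (ordinal_mem _ _ (IH w Hw) Hy).
Qed.

Lemma rank_mem x y : x ∈ y -> rank x ∈ rank y.
Proof. intros H; apply mem_rank; eauto. Qed.

Lemma rank_ordinal a : ordinal a -> rank a = a.
Proof.
  induction a as [a IH] using (well_founded_ind mem_wf); intros Oa.
  assert (E : forall y, y ∈ a -> rank y = y) by
    (intros y Hy; apply IH; auto; exact (ordinal_mem _ _ Oa Hy)).
  apply set_ext; intros z; rewrite mem_rank; split.
  - intros [y Hy Hz]; rewrite (E y Hy) in Hz; destruct Hz as [Hz| ->]; auto.
    exact (ordinal_trans _ _ _ Oa Hz Hy).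
  - intros Hz; exists z; auto; right; symmetry; auto.
Qed.

Lemma R_transitive κ x y : ordinal κ -> x ∈ y -> y ∈ R κ -> x ∈ R κ.
Proof.
  intros O H; rewrite !mem_R; intros H'.
  exact (ordinal_trans _ _ _ O (rank_mem _ _ H) H').
Qed.

Lemma R_mono μ κ : ordinal κ -> μ ∈ κ -> R μ ⊆ R κ.
Proof. intros O H x; rewrite !mem_R; intros Hx; exact (ordinal_trans _ _ _ O Hx H). Qed.

Lemma ordinal_in_R κ a : ordinal κ -> a ∈ κ -> a ∈ R κ.
Proof.
  intros O H; apply mem_R; rewrite rank_ordinal; auto; exact (ordinal_mem _ _ O H).
Qed.

Lemma ordinal_in_R_inv κ a : ordinal a -> a ∈ R κ -> a ∈ κ.
Proof. intros O H; apply mem_R in H; now rewrite rank_ordinal in H. Qed.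

(** * Natural numbers as ordinals *)

Fixpoint num (n : nat) : V :=
  match n with O => cls (node False (False_rect tree)) | S n => succ (num n) end.

Lemma mem_empty x : x ∉ num 0.
Proof. intros H; apply mem_node in H as [[]]. Qed.

Lemma mem_num n x : x ∈ num n <-> exists2 m, m < n & x = num m.
Proof.
  induction n as [|n IH].
  - split; [intros H; destruct (mem_empty _ H)|intros [m Hm]; lia].
  - simpl; rewrite mem_succ, IH; split.
    + intros [[m Hm ->]| ->]; [exists m|exists n]; auto.
    + intros [m Hm ->]; destruct (PeanoNat.Nat.eq_dec m n) as [->|]; auto.
      left; exists m; auto; lia.
Qed.

Lemma num_lt n m : n < m -> num n ∈ num m.
Proof. intros H; apply mem_num; eauto. Qed.

Lemma num_inj n m : num n = num m -> n = m.
Proof.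
  intros E; destruct (Compare_dec.lt_eq_lt_dec n m) as [[H| ]|H]; auto;
  apply num_lt in H; rewrite E in H; destruct (mem_irrefl _ H).
Qed.

Lemma ordinal_num n : ordinal (num n).
Proof.
  induction n; [|now apply ordinal_succ].
  split; intros y Hy; destruct (mem_empty _ Hy).
Qed.

Lemma is_set_range (A : Type) (F : A -> V) : is_set (fun x => exists i, x = F i).
Proof.
  destruct (choice (fun i t => F i = cls t)) as [f Hf]; [intros; apply cls_surj|].
  exists (cls (node A f)); intros x; rewrite mem_node.
  split; intros [i ->]; exists i; now rewrite Hf.
Qed.

Definition omega : V := setof (fun x => exists n, x = num n).

Lemma mem_omega x : x ∈ omega <-> exists n, x = num n.
Proof. apply (mem_setof (fun x => exists n, x = num n)), is_set_range. Qed.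

Lemma ordinal_omega : ordinal omega.
Proof.
  apply ordinal_of_mems.
  - intros y Hy z Hz; apply mem_omega in Hy as [n ->]; apply mem_num in Hz as [m _ ->].
    apply mem_omega; eauto.
  - intros x Hx; apply mem_omega in Hx as [n ->]; apply ordinal_num.
Qed.

(** * Cardinals *)

Lemma Ensemble_ext (A B : Ensemble V) : (forall x, A x <-> B x) -> A = B.
Proof.
  intros H; apply functional_extensionality; intros x.
  apply propositional_extensionality, H.
Qed.

(** The Cantor-Bernstein theorem for a subset [B] of [A]: the bijection is [f] on
    the points reached from [A] minus [B] by iterating [f], and the identity on
    the others. *)
Lemma injects_subset_equipotent (A B : Ensemble V) (f : V -> V) :
  (forall x, B x -> A x) -> (forall x, A x -> B (f x)) ->
  (forall x y, A x -> A y -> f x = f y -> x = y) -> equipotent A B.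
Proof.
  intros BA Hf Inj.
  pose (C x := exists y n, A y /\ ~ B y /\ x = Nat.iter n f y).
  assert (CA : forall n y, A y -> A (Nat.iter n f y)).
  { intros n y Hy; induction n; simpl; auto. }
  pose (h x := if excluded_middle_informative (C x) then f x else x).
  assert (h1 : forall x, C x -> h x = f x).
  { intros x Hx; unfold h; now destruct (excluded_middle_informative (C x)). }
  assert (h2 : forall x, ~ C x -> h x = x).
  { intros x Hx; unfold h; now destruct (excluded_middle_informative (C x)). }
  assert (Cf : forall x, C x -> C (f x)).
  { intros x (y & n & H & H' & ->); exists y, (S n); auto. }
  exists h; split; [|split].
  - intros x Hx; destruct (classic (C x)) as [c|c].
    + rewrite h1; auto.
    + rewrite h2; auto; apply NNPP; intros N; apply c; exists x, 0; auto.
  - intros x y Hx Hy; destruct (classic (C x)) as [c|c], (classic (C y)) as [c'|c'];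
    rewrite ?(h1 x c), ?(h2 x c), ?(h1 y c'), ?(h2 y c'); auto; intros E; exfalso.
    + apply c'; rewrite <- E; auto.
    + apply c; rewrite E; auto.
  - intros y Hy; destruct (classic (C y)) as [c|c]; [|exists y; auto].
    destruct c as (z & [|n] & Az & Bz & ->); [easy|]; simpl.
    exists (Nat.iter n f z); auto; apply h1; exists z, n; auto.
Qed.

Lemma cardinal_no_injection κ β (f : V -> V) :
  is_cardinal κ -> β ∈ κ -> (forall x, x ∈ κ -> f x ∈ β) ->
  ~ (forall x y, x ∈ κ -> y ∈ κ -> f x = f y -> x = y).
Proof.
  intros [O C] Hβ Hf Inj; apply (C β Hβ).
  apply (injects_subset_equipotent (elts κ) (elts β) f); auto.
  intros x Hx; exact (ordinal_trans _ _ _ O Hx Hβ).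
Qed.

Lemma finite_num n : Finite V (elts (num n)).
Proof.
  induction n as [|n IH].
  - replace (elts (num 0)) with (Empty_set V); [constructor|].
    apply Ensemble_ext; intros x; split; [intros []|intros H; destruct (mem_empty _ H)].
  - replace (elts (num (S n))) with (Ensembles.Add V (elts (num n)) (num n)).
    + constructor; auto; apply mem_irrefl.
    + apply Ensemble_ext; intros x; unfold elts; simpl; rewrite mem_succ.
      split; [intros [? H|? H]; [auto|destruct H; auto]|].
      intros [H|H]; [left|right]; auto; rewrite H; constructor.
Qed.

Section InfiniteCardinal.
Context (θ : V) (Cθ : is_cardinal θ) (Iθ : infinite θ).

Let Oθ : ordinal θ := proj1 Cθ.

Lemma num_mem_infinite n : num n ∈ θ.
Proof.
  destruct (ordinal_trichotomy (num n) θ (ordinal_num n) Oθ) as [H|H]; auto; exfalso.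
  assert (E : exists m, θ = num m).
  { destruct H as [H|H]; [eauto|]; apply mem_num in H as [m _ ->]; eauto. }
  destruct E as [m E]; apply Iθ; rewrite E; apply finite_num.
Qed.

Lemma infinite_cardinal_succ β : β ∈ θ -> succ β ∈ θ.
Proof.
  intros Hβ; assert (Oβ := ordinal_mem _ _ Oθ Hβ).
  destruct (ordinal_trichotomy (succ β) θ (ordinal_succ _ Oβ) Oθ) as [H|[E|H]]; auto; exfalso.
  2:{ apply mem_succ in H as [H| ->]; [exact (mem_asym _ _ H Hβ)|exact (mem_irrefl _ Hβ)]. }
  assert (Hn : forall n, num n ∈ β).
  { intros n; assert (H := num_mem_infinite n); rewrite <- E in H.
    apply mem_succ in H as [H|H]; auto; exfalso; apply (mem_irrefl θ).
    rewrite <- E at 1; rewrite <- H; exact (num_mem_infinite (S n)). }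
  (* the hotel of Hilbert: shift the natural numbers to make room for [β] *)
  pose (h x := if excluded_middle_informative (x = β) then num 0 else
    epsilon (inhabits x) (fun y => (exists2 n, x = num n & y = num (S n)) \/
                                   (~ (exists n, x = num n) /\ y = x))).
  assert (h0 : h β = num 0).
  { unfold h; now destruct (excluded_middle_informative (β = β)). }
  assert (h1 : forall x, x <> β -> (exists2 n, x = num n & h x = num (S n)) \/
                                   (~ (exists n, x = num n) /\ h x = x)).
  { intros x Hx; unfold h; destruct (excluded_middle_informative (x = β)); [easy|].
    apply (epsilon_spec (inhabits x) (fun y => (exists2 n, x = num n & y = num (S n)) \/
                                   (~ (exists n, x = num n) /\ y = x))).
    destruct (classic (exists n, x = num n)) as [[k Hk]|N]; eauto. }
  apply (cardinal_no_injection θ β h Cθ Hβ).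
  - intros x Hx; destruct (classic (x = β)) as [->|Nx]; [rewrite h0; auto|].
    rewrite <- E in Hx; apply mem_succ in Hx as [Hx|Hx]; [|easy].
    destruct (h1 x Nx) as [[n _ ->]|[_ ->]]; auto.
  - intros x y Hx Hy Hh.
    destruct (classic (x = β)) as [->|Nx], (classic (y = β)) as [->|Ny]; auto.
    + exfalso; rewrite h0 in Hh; destruct (h1 y Ny) as [[n _ H]|[N H]]; rewrite H in Hh.
      * apply num_inj in Hh; easy.
      * eauto.
    + exfalso; rewrite h0 in Hh; destruct (h1 x Nx) as [[n _ H]|[N H]]; rewrite H in Hh.
      * apply num_inj in Hh; easy.
      * eauto.
    + destruct (h1 x Nx) as [[n Ex H]|[N H]], (h1 y Ny) as [[m Ey H']|[N' H']];
      rewrite H, H' in Hh; auto.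
      * apply num_inj in Hh; injection Hh as ->; congruence.
      * exfalso; eauto.
      * exfalso; eauto.
Qed.

Definition unbounded (H : V) : Prop := forall β, β ∈ θ -> exists2 h, h ∈ H & β ∈ h.

Lemma equipotent_unbounded H : H ⊆ θ -> equipotent (elts H) (elts θ) -> unbounded H.
Proof.
  intros Hs (f & _ & _ & Surj) β Hβ; apply NNPP; intros N.
  destruct (choice (fun y x => y ∈ θ -> x ∈ H /\ f x = y)) as [g Hg].
  { intros y; destruct (classic (y ∈ θ)) as [Hy|Hy]; [|now exists y].
    destruct (Surj y Hy) as [x Hx E]; now exists x. }
  apply (cardinal_no_injection θ (succ β) g Cθ (infinite_cardinal_succ _ Hβ)).
  - intros y Hy; destruct (Hg y Hy) as [H1 _]; apply mem_succ.
    assert (Og := ordinal_mem _ _ Oθ (Hs _ H1)); assert (Oβ := ordinal_mem _ _ Oθ Hβ).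
    destruct (ordinal_trichotomy (g y) β Og Oβ) as [h|[h|h]]; auto; exfalso; apply N; eauto.
  - intros x y Hx Hy E; destruct (Hg x Hx) as [_ <-], (Hg y Hy) as [_ <-]; now rewrite E.
Qed.

Lemma list_bounded l : (forall x, In x l -> x ∈ θ) ->
  exists2 β, β ∈ θ & forall x, In x l -> x ∈ β.
Proof.
  induction l as [|a l IH]; intros Hl.
  - exists (num 0); [apply num_mem_infinite|intros x []].
  - destruct IH as [β Hβ Hb]; [intros; apply Hl; now right|].
    assert (Ha : a ∈ θ) by (apply Hl; now left).
    assert (Hsa := infinite_cardinal_succ _ Ha).
    assert (Oa := ordinal_mem _ _ Oθ Hsa); assert (Ob := ordinal_mem _ _ Oθ Hβ).
    destruct (classic (β ∈ succ a)) as [H|H].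
    + exists (succ a); auto; intros x [<-|Hx]; [apply mem_succ; auto|].
      exact (ordinal_trans _ _ _ Oa (Hb x Hx) H).
    + exists β; auto; intros x [<-|Hx]; auto.
      apply (ordinal_mem_not_mem (succ a)); auto; apply mem_succ; auto.
Qed.

End InfiniteCardinal.

(** * Increasing lists of ordinals *)

Definition increasing (H : V) (l : list V) : Prop :=
  StronglySorted mem l /\ forall x, In x l -> x ∈ H.

Lemma increasing_nil H : increasing H [].
Proof. split; [constructor|intros x []]. Qed.

Lemma increasing_cons H a l :
  increasing H (a :: l) <-> a ∈ H /\ (forall x, In x l -> a ∈ x) /\ increasing H l.
Proof.
  split.
  - intros [S HI]; apply StronglySorted_inv in S as [S F].
    rewrite Forall_forall in F; repeat split; auto; [apply HI; now left|].
    intros; apply HI; now right.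
  - intros (Ha & F & S & HI); split; [constructor; auto; now apply Forall_forall|].
    intros x [<-|Hx]; auto.
Qed.

Lemma increasing_app H l m :
  increasing H (l ++ m) <->
  increasing H l /\ increasing H m /\ forall x y, In x l -> In y m -> x ∈ y.
Proof.
  induction l as [|a l IH]; simpl.
  - split; [intros Hm|tauto].
    split; [apply increasing_nil|split; auto; intros x y []].
  - rewrite !increasing_cons, IH; split.
    + intros (Ha & F & Hl & Hm & Hlm).
      assert (F' : forall x, In x l -> a ∈ x) by (intros; apply F, in_or_app; auto).
      split; [tauto|split; [tauto|]].
      intros x y [<-|Hx] Hy; auto; apply F, in_or_app; auto.
    + intros ((Ha & F & Hl) & Hm & Hlm).
      assert (F' : forall x, In x (l ++ m) -> a ∈ x).
      { intros x Hx; apply in_app_or in Hx as [Hx|Hx]; auto. }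
      split; [auto|split; [auto|split; [auto|split; auto]]].
Qed.

Lemma increasing_unique H l l' :
  increasing H l -> increasing H l' -> (forall x, In x l <-> In x l') -> l = l'.
Proof.
  revert l'; induction l as [|a l IH]; intros [|b l'] Hl Hl' E; auto.
  - destruct (proj2 (E b)); now left.
  - destruct (proj1 (E a)); now left.
  - apply increasing_cons in Hl as (_ & F & Hl); apply increasing_cons in Hl' as (_ & F' & Hl').
    assert (Eab : a = b).
    { destruct (proj1 (E a)) as [|Ha]; [now left|auto|].
      destruct (proj2 (E b)) as [|Hb]; [now left|auto|].
      destruct (mem_asym _ _ (F _ Hb) (F' _ Ha)). }
    subst b; f_equal; apply IH; auto; intros x; split; intros Hx.
    + destruct (proj1 (E x)) as [<-|H']; [now right| |auto].
      destruct (mem_irrefl _ (F _ Hx)).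
    + destruct (proj2 (E x)) as [<-|H']; [now right| |auto].
      destruct (mem_irrefl _ (F' _ Hx)).
Qed.

Lemma increasing_NoDup H l : increasing H l -> NoDup l.
Proof.
  induction l as [|a l IH]; [constructor|].
  rewrite increasing_cons; intros (_ & F & Hl); constructor; auto.
  intros Ha; exact (mem_irrefl _ (F _ Ha)).
Qed.

Lemma cardinal_list (l : list V) : NoDup l -> cardinal V (fun x => In x l) (length l).
Proof.
  induction 1 as [|a l Ha Hl IH]; simpl.
  - replace (fun x : V => False) with (Empty_set V); [constructor|].
    apply Ensemble_ext; intros x; split; intros [].
  - replace (fun x : V => a = x \/ In x l) with (Ensembles.Add V (fun x => In x l) a).
    + now constructor.
    + apply Ensemble_ext; intros x; split.
      * intros [? H|? H]; [now right|destruct H; now left].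
      * intros [<-|H]; [right; constructor|now left].
Qed.

Lemma mem_setof_list (l : list V) H : (forall x, In x l -> x ∈ H) ->
  forall x, x ∈ setof (fun x => In x l) <-> In x l.
Proof. intros Hl; apply (mem_setof (fun x => In x l)), (is_set_sub _ H); auto. Qed.

Lemma increasing_above θ H n β :
  ordinal θ -> H ⊆ θ -> unbounded θ H -> β ∈ θ ->
  exists l, increasing H l /\ length l = n /\ forall x, In x l -> β ∈ x.
Proof.
  intros O Hs U; revert β; induction n as [|n IH]; intros β Hβ.
  - exists []; split; [apply increasing_nil|]; split; [auto|intros x []].
  - destruct (U β Hβ) as [h Hh Hβh]; destruct (IH h (Hs _ Hh)) as (l & Hl & <- & Ha).
    exists (h :: l); split; [apply increasing_cons; auto|split; auto].
    intros x [<-|Hx]; auto.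
    exact (ordinal_trans _ _ _ (ordinal_mem _ _ O (Hs _ (proj2 Hl x Hx))) Hβh (Ha x Hx)).
Qed.

Definition homogeneous (H : V) (G : list V -> Prop) : Prop :=
  forall l l', increasing H l -> increasing H l' -> length l = length l' -> (G l <-> G l').

(** Countably many colourings of increasing lists become one colouring of finite
    sets: the size of a finite set codes both the index [k] of a colouring and
    the number of first elements that this colouring looks at.  The other
    elements are padding, which exists because homogeneous sets are unbounded. *)
Lemma ramsey_homogeneous θ (G : nat -> list V -> Prop) :
  ramsey θ ->
  exists H, H ⊆ θ /\ equipotent (elts H) (elts θ) /\ unbounded θ H /\
    forall k, homogeneous H (G k).
Proof.
  intros (C & Inf & Ram); assert (O := proj1 C).
  pose (srt s := epsilon (inhabits []) (fun l => increasing θ l /\ forall x, In x l <-> x ∈ s)).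
  pose (Q l := G (fst (of_nat (length l))) (firstn (snd (of_nat (length l))) l)).
  destruct (Ram (fun s => if excluded_middle_informative (Q (srt s)) then true else false))
    as (H & Hs & Eq & Hom).
  assert (U := equipotent_unbounded θ C Inf H Hs Eq).
  exists H; split; [auto|split; [auto|split; [auto|]]]; intros k.
  assert (Hsrt : forall l, increasing H l -> srt (setof (fun x => In x l)) = l).
  { intros l Hl; assert (M := mem_setof_list l H (proj2 Hl)).
    assert (Hl' : increasing θ l) by (split; [apply Hl|intros x Hx; apply Hs, Hl, Hx]).
    destruct (epsilon_spec (inhabits []) (fun m => increasing θ m /\
      forall x, In x m <-> x ∈ setof (fun x => In x l))) as [S1 S2].
    { exists l; split; auto; intros x; now rewrite M. }
    apply (increasing_unique θ); auto; intros x; rewrite <- M; apply S2. }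
  assert (HQ : forall l l', increasing H l -> increasing H l' -> length l = length l' ->
    Q l -> Q l').
  { intros l l' Hl Hl' E.
    assert (EH := Hom (length l) (setof (fun x => In x l)) (setof (fun x => In x l'))).
    rewrite !Hsrt in EH by auto.
    destruct (excluded_middle_informative (Q l)), (excluded_middle_informative (Q l')); try easy.
    assert (F : true = false); [apply EH|easy].
    - intros x Hx; apply (mem_setof_list l H) in Hx; apply Hl; auto.
    - intros x Hx; apply (mem_setof_list l' H) in Hx; apply Hl'; auto.
    - replace (elts (setof (fun x => In x l))) with (fun x => In x l).
      + apply cardinal_list, (increasing_NoDup H), Hl.
      + apply Ensemble_ext; intros x; symmetry; apply (mem_setof_list l H), Hl.
    - rewrite E; replace (elts (setof (fun x => In x l'))) with (fun x => In x l').
      + apply cardinal_list, (increasing_NoDup H), Hl'.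
      + apply Ensemble_ext; intros x; symmetry; apply (mem_setof_list l' H), Hl'. }
  assert (Ext : forall l, increasing H l -> exists m, increasing H (l ++ m) /\
    length (l ++ m) = to_nat (k, length l)).
  { intros l Hl; destruct (list_bounded θ C Inf l) as [β Hβ Hb].
    { intros x Hx; apply Hs, Hl, Hx. }
    destruct (increasing_above θ H (to_nat (k, length l) - length l) β O Hs U Hβ)
      as (m & Hm & Lm & Ha).
    exists m; split; [apply increasing_app; split; [auto|split; auto]|].
    - intros x y Hx Hy.
      refine (ordinal_trans _ _ _ (ordinal_mem _ _ O (Hs _ (proj2 Hm y Hy))) (Hb x Hx) (Ha y Hy)).
    - rewrite length_app, Lm; assert (L := to_nat_non_decreasing k (length l)); lia. }
  assert (QG : forall l m, length (l ++ m) = to_nat (k, length l) -> Q (l ++ m) <-> G k l).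
  { intros l m E; unfold Q; rewrite E, cancel_of_to; simpl fst; simpl snd.
    now rewrite firstn_app, firstn_all, PeanoNat.Nat.sub_diag, app_nil_r. }
  intros l l' Hl Hl' E; destruct (Ext l Hl) as (m & Hm & Lm), (Ext l' Hl') as (m' & Hm' & Lm').
  rewrite <- (QG l m), <- (QG l' m') by auto.
  assert (LL : length (l ++ m) = length (l' ++ m')) by (rewrite Lm, Lm'; congruence).
  split; apply HQ; auto.
Qed.

(** * Regularity and small types *)

Lemma increasing2 H a b : a ∈ H -> b ∈ H -> a ∈ b -> increasing H [a; b].
Proof.
  intros Ha Hb Hab; apply increasing_cons; split; auto; split.
  - intros x [<-|[]]; auto.
  - apply increasing_cons; split; auto; split; [intros x []|apply increasing_nil].
Qed.

Lemma increasing3 θ H a b c : ordinal θ -> H ⊆ θ -> a ∈ H -> b ∈ H -> c ∈ H ->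
  a ∈ b -> b ∈ c -> increasing H [a; b; c].
Proof.
  intros O Hs Ha Hb Hc Hab Hbc; apply increasing_cons; split; auto; split.
  - intros x [<-|[<-|[]]]; auto.
    exact (ordinal_trans _ _ _ (ordinal_mem _ _ O (Hs _ Hc)) Hab Hbc).
  - apply increasing2; auto.
Qed.

(** If [θ] is the union of fewer than [θ] initial segments, colour a pair by
    whether the same segment is chosen for both elements: a homogeneous set of
    size [θ] neither lies in one segment nor injects into the set of segments. *)
Lemma ramsey_regular θ : ramsey θ -> regular θ.
Proof.
  intros Ram β f Hβ Hf; apply NNPP; intros N.
  assert (C := proj1 Ram); assert (O := proj1 C).
  destruct (choice (fun x ξ => x ∈ θ -> ξ ∈ β /\ x ∈ succ (f ξ))) as [p Hp].
  { intros x; destruct (classic (x ∈ θ)) as [Hx|Hx]; [|now exists x].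
    apply NNPP; intros N'; apply N; exists x; auto; intros ξ Hξ; apply NNPP; intros N''.
    apply N'; exists ξ; intros _; split; auto; apply mem_succ.
    destruct (ordinal_not_mem (f ξ) x (ordinal_mem _ _ O (Hf ξ Hξ)) (ordinal_mem _ _ O Hx) N'');
    auto. }
  destruct (ramsey_homogeneous θ (fun _ l => forall x y, In x l -> In y l -> p x = p y) Ram)
    as (H & Hs & (e & _ & _ & Surj) & U & Hom); specialize (Hom 0).
  destruct (classic (exists a b, a ∈ H /\ b ∈ H /\ a ∈ b /\ p a = p b)) as [(a & b & Ha & Hb & Hab & E)|Nx].
  - destruct (Hp a (Hs _ Ha)) as [p1 _].
    destruct (U (succ (f (p a)))) as [h Hh Hlt].
    { apply infinite_cardinal_succ; auto; apply Ram. }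
    destruct (Hp h (Hs _ Hh)) as [_ p2].
    assert (Oh := ordinal_mem _ _ O (Hs _ Hh)).
    destruct (U h (Hs _ Hh)) as [k Hk Hhk].
    assert (Eah : p a = p h).
    { destruct (ordinal_trichotomy a h (ordinal_mem _ _ O (Hs _ Ha)) Oh) as [L|[->|L]]; auto.
      - refine (proj1 (Hom [a; b] [a; h] _ _ eq_refl) _ a h _ _); simpl; auto.
        + apply increasing2; auto.
        + apply increasing2; auto.
        + intros x y [<-|[<-|[]]] [<-|[<-|[]]]; auto.
      - refine (proj1 (Hom [a; b] [h; a] _ _ eq_refl) _ a h _ _); simpl; auto.
        + apply increasing2; auto.
        + apply increasing2; auto.
        + intros x y [<-|[<-|[]]] [<-|[<-|[]]]; auto. }
    rewrite Eah in Hlt; exact (mem_asym _ _ Hlt p2).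
  - destruct (choice (fun y x => y ∈ θ -> x ∈ H /\ e x = y)) as [g Hg].
    { intros y; destruct (classic (y ∈ θ)) as [Hy|Hy]; [|now exists y].
      destruct (Surj y Hy) as [x Hx E]; now exists x. }
    apply (cardinal_no_injection θ β (fun x => p (g x)) C Hβ).
    + intros x Hx; apply Hp, Hs, Hg, Hx.
    + intros x y Hx Hy E; destruct (Hg x Hx) as [Gx <-], (Hg y Hy) as [Gy <-]; f_equal.
      destruct (ordinal_trichotomy (g x) (g y) (ordinal_mem _ _ O (Hs _ Gx))
        (ordinal_mem _ _ O (Hs _ Gy))) as [L|[L|L]]; auto; exfalso; apply Nx.
      * exists (g x), (g y); auto.
      * exists (g y), (g x); auto.
Qed.

(** For [θ = omega], colour a finite set by comparing its least element with its
    size: an infinite set has subsets of one size and of both colours. *)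
Lemma ramsey_omega θ : ramsey θ -> omega ∈ θ.
Proof.
  intros Ram; assert (C := proj1 Ram); assert (O := proj1 C).
  destruct (ordinal_trichotomy omega θ ordinal_omega O) as [H|[E|H]]; auto; exfalso.
  2:{ apply mem_omega in H as [n E]; apply (proj1 (proj2 Ram)); rewrite E; apply finite_num. }
  destruct (ramsey_homogeneous θ (fun _ l => match l with
      [] => True | a :: _ => exists m, m < length l /\ a = num m end) Ram)
    as (H & Hs & _ & U & Hom); specialize (Hom 0).
  destruct (U (num 0)) as [a Ha _]; [apply num_mem_infinite; auto; apply Ram|].
  assert (Ea := Hs _ Ha); rewrite <- E in Ea; apply mem_omega in Ea as [m ->].
  destruct (increasing_above θ H m (num m) O Hs U (Hs _ Ha)) as (l & Hl & Ll & Al).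
  destruct (increasing_above θ H (S m) (num m) O Hs U (Hs _ Ha)) as (l' & Hl' & Ll' & Al').
  destruct l' as [|b l']; [easy|].
  destruct (proj1 (Hom (num m :: l) (b :: l') ltac:(apply increasing_cons; auto) Hl'
    ltac:(simpl in *; lia))) as (k & Hk & Eb).
  - exists m; simpl; split; auto; lia.
  - assert (Hm : num m ∈ b) by (apply Al'; now left).
    rewrite Eb in Hm; apply mem_num in Hm as [j Hj Hm]; apply num_inj in Hm.
    simpl in *; lia.
Qed.

Section Small.
Context (θ : V).

(** This stands for a type of fewer than [θ] elements.  It is used with no
    cardinal arithmetic: power types are [small] by partition properties, and
    everything else injects into iterated power types. *)
Definition small (X : Type) : Prop :=
  exists2 β, β ∈ θ & exists f : X -> V, (forall x, f x ∈ β) /\ forall x y, f x = f y -> x = y.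

Lemma small_injection X Y (f : X -> Y) :
  small Y -> (forall x y, f x = f y -> x = y) -> small X.
Proof.
  intros [β Hβ (g & Hg & Inj)] Hf; exists β; auto; exists (fun x => g (f x)); auto.
Qed.

Lemma small_mems β : β ∈ θ -> small {x | x ∈ β}.
Proof.
  intros Hβ; exists β; auto; exists (@proj1_sig _ _); split; [intros [x Hx]; auto|].
  intros [x Hx] [y Hy]; simpl; intros <-; f_equal; apply proof_irrelevance.
Qed.

Context (Oθ : ordinal θ) (Reg : regular θ) (T0 : num 0 ∈ θ).

Lemma small_bounded X (b : X -> V) : small X -> (forall x, b x ∈ θ) ->
  exists2 γ, γ ∈ θ & forall x, b x ∈ γ.
Proof.
  intros [β Hβ (f & Hf & Inj)] Hb.
  destruct (choice (fun ξ y => (exists2 x, f x = ξ & y = b x) \/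
                               (~ (exists x, f x = ξ) /\ y = num 0))) as [g Hg].
  { intros ξ; destruct (classic (exists x, f x = ξ)) as [[x E]|N]; eauto. }
  destruct (Reg β g Hβ) as [γ Hγ HF].
  { intros ξ Hξ; destruct (Hg ξ) as [[x _ ->]|[_ ->]]; auto. }
  exists γ; auto; intros x; destruct (Hg (f x)) as [[y E E']|[N _]].
  - apply Inj in E as ->; rewrite <- E'; auto.
  - destruct N; eauto.
Qed.

Lemma pigeonhole X (τ : V -> X) H : unbounded θ H -> H ⊆ θ -> small X ->
  exists x, forall β, β ∈ θ -> exists h, h ∈ H /\ β ∈ h /\ τ h = x.
Proof.
  intros U Hs SX; apply NNPP; intros N.
  destruct (choice (fun x β => β ∈ θ /\ forall h, h ∈ H -> β ∈ h -> τ h <> x)) as [b Hb].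
  { intros x; apply NNPP; intros N'; apply N; exists x; intros β Hβ.
    apply NNPP; intros N''; apply N'; exists β; split; auto; intros h Hh Hβh E.
    apply N''; eauto. }
  destruct (small_bounded X b SX) as [γ Hγ Hbγ]; [apply Hb|].
  destruct (U γ Hγ) as [h Hh Hγh].
  apply (proj2 (Hb (τ h)) h Hh); auto.
  exact (ordinal_trans _ _ _ (ordinal_mem _ _ Oθ (Hs _ Hh)) (Hbγ _) Hγh).
Qed.

(** Enumerate [X] along [θ] without repetition, until [X] or [θ] is exhausted. *)
Lemma enumeration X : inhabited X ->
  (exists e : V -> X, forall i j, i ∈ θ -> j ∈ θ -> e i = e j -> i = j) \/
  (exists2 ζ, ζ ∈ θ & exists e : V -> X,
    (forall i j, i ∈ ζ -> j ∈ ζ -> e i = e j -> i = j) /\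
    (forall x, exists2 i, i ∈ ζ & e i = x)).
Proof.
  intros inh.
  pose (e := Fix mem_wf (fun _ => X) (fun i rec =>
    epsilon inh (fun x => forall j (h : j ∈ i), rec j h <> x))).
  assert (Ee : forall i, e i = epsilon inh (fun x => forall j, j ∈ i -> e j <> x)).
  { intros i; unfold e at 1; rewrite Fix_eq; [reflexivity|].
    intros u f g Hfg; f_equal; apply functional_extensionality; intros x.
    apply propositional_extensionality; split; intros H j h; [rewrite <- Hfg|rewrite Hfg]; auto. }
  assert (Inj : forall ζ, ordinal ζ ->
    (forall i, i ∈ ζ -> exists x, forall j, j ∈ i -> e j <> x) ->
    forall i j, i ∈ ζ -> j ∈ ζ -> e i = e j -> i = j).
  { intros ζ Oζ Hζ.
    assert (L : forall i j, i ∈ ζ -> j ∈ i -> e j <> e i).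
    { intros i j Hi Hj; rewrite (Ee i).
      apply (epsilon_spec inh (fun x => forall j, j ∈ i -> e j <> x)); auto. }
    intros i j Hi Hj E.
    destruct (ordinal_trichotomy i j (ordinal_mem _ _ Oζ Hi) (ordinal_mem _ _ Oζ Hj))
      as [H|[H|H]]; auto; exfalso; [apply (L j i)|apply (L i j)]; auto. }
  destruct (classic (exists ζ, ζ ∈ θ /\ forall x, exists2 i, i ∈ ζ & e i = x)) as [[ζ Hζ]|N].
  - right; destruct (mem_min (fun ζ => ζ ∈ θ /\ forall x, exists2 i, i ∈ ζ & e i = x) ζ Hζ)
      as (ξ & (Hξ & Surj) & Min); exists ξ; auto; exists e; split; auto.
    apply Inj; [exact (ordinal_mem _ _ Oθ Hξ)|intros i Hi].
    apply NNPP; intros N; apply (Min i Hi); split; [exact (ordinal_trans _ _ _ Oθ Hi Hξ)|].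
    intros x; apply NNPP; intros N'; apply N; exists x; intros j Hj E; eauto.
  - left; exists e; apply Inj; auto; intros i Hi; apply NNPP; intros N'; apply N; exists i.
    split; auto; intros x; apply NNPP; intros N''; apply N'; exists x; intros j Hj E; eauto.
Qed.

End Small.

(** * First differences *)

Section Difference.
Context (X : Type) (rk : X -> V) (T : V -> X -> Prop) (Ork : forall x, ordinal (rk x)).

Definition first_difference_spec a b ρ : Prop :=
  (exists x, rk x = ρ /\ ~ (T a x <-> T b x)) /\ forall x, rk x ∈ ρ -> (T a x <-> T b x).

(** The predicates [T a] on a ranked type are compared level by level, as one
    compares sequences lexicographically.  The value matters only when [T a]
    and [T b] differ somewhere. *)
Definition first_difference a b : V := epsilon (inhabits a) (first_difference_spec a b).

Notation Δ := first_difference.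

Lemma first_differenceP a b x : ~ (T a x <-> T b x) -> first_difference_spec a b (Δ a b).
Proof.
  intros N; apply (epsilon_spec (inhabits a) (first_difference_spec a b)).
  destruct (mem_min (fun ρ => exists x, rk x = ρ /\ ~ (T a x <-> T b x)) (rk x)) as (ρ & H & Min);
    [eauto|].
  exists ρ; split; auto; intros y Hy; apply NNPP; intros N'; apply (Min (rk y)); eauto.
Qed.

Lemma first_difference_unique a b ρ : first_difference_spec a b ρ -> Δ a b = ρ.
Proof.
  intros H; assert (H' := H); destruct H' as [(x & E & N) A].
  destruct (first_differenceP a b x N) as [(y & E' & N') A'].
  rewrite <- E in *; rewrite <- E' in *.
  destruct (ordinal_trichotomy (rk x) (rk y) (Ork x) (Ork y)) as [L|[L|L]]; auto; exfalso; auto.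
Qed.

Definition separates (H : V) : Prop :=
  forall a b, a ∈ H -> b ∈ H -> a ∈ b -> exists x, ~ (T a x <-> T b x).

Lemma first_difference_ordinal H a b : separates H -> a ∈ H -> b ∈ H -> a ∈ b -> ordinal (Δ a b).
Proof.
  intros S Ha Hb Hab; destruct (S a b Ha Hb Hab) as [x Hx].
  destruct (first_differenceP a b x Hx) as [(y & <- & _) _]; auto.
Qed.

Lemma first_difference_trans a b c x y :
  ~ (T a x <-> T b x) -> ~ (T b y <-> T c y) -> Δ a b ∈ Δ b c -> Δ a c = Δ a b.
Proof.
  intros Nx Ny L; apply first_difference_unique.
  destruct (first_differenceP a b x Nx) as [(x' & E & N) A].
  destruct (first_differenceP b c y Ny) as [(y' & E' & N') A'].
  split.
  - exists x'; split; auto; rewrite <- E in L; specialize (A' x' L); tauto.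
  - intros z Hz; rewrite (A z Hz); apply A'.
    rewrite <- E' in *; exact (ordinal_trans _ _ _ (Ork y') Hz L).
Qed.

(** When differences never move up along [H], take a pair whose difference is
    least: it then propagates to all later pairs. *)
Lemma first_difference_stable H a0 b0 :
  a0 ∈ H -> b0 ∈ H -> a0 ∈ b0 -> separates H ->
  (forall a b c, a ∈ H -> b ∈ H -> c ∈ H -> a ∈ b -> b ∈ c -> Δ a b ∉ Δ b c) ->
  exists m b, b ∈ H /\ ordinal m /\
    forall c d, c ∈ H -> d ∈ H -> b ∈ c -> c ∈ d -> Δ c d = m.
Proof.
  intros Ha0 Hb0 L0 S N.
  destruct (mem_min (fun m => exists a b, a ∈ H /\ b ∈ H /\ a ∈ b /\ Δ a b = m) (Δ a0 b0))
    as (m & (a & b & Ha & Hb & Hab & E) & Min); [exists a0, b0; auto|].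
  assert (Om : ordinal m) by (rewrite <- E; apply (first_difference_ordinal H); auto).
  assert (Next : forall a b c, a ∈ H -> b ∈ H -> c ∈ H -> a ∈ b -> b ∈ c -> Δ a b = m -> Δ b c = m).
  { intros x y z Hx Hy Hz Hxy Hyz Ex.
    assert (Oz : ordinal (Δ y z)) by (apply (first_difference_ordinal H); auto).
    destruct (ordinal_trichotomy (Δ y z) m Oz Om) as [L|[L|L]]; auto; exfalso.
    - apply (Min _ L); exists y, z; auto.
    - rewrite <- Ex in L; exact (N x y z Hx Hy Hz Hxy Hyz L). }
  exists m, b; split; [auto|split; [auto|]]; intros c d Hc Hd Hbc Hcd.
  apply (Next b c d); auto; apply (Next a b c); auto.
Qed.

(** When differences move up along [H], [T b] and [T c] agree at the level where
    [T a] and [T b] first differ, so this level depends on [a] alone. *)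
Lemma first_difference_increasing H (nx : V -> V) a b :
  (forall x, x ∈ H -> ordinal x) -> (forall h, h ∈ H -> nx h ∈ H /\ h ∈ nx h) -> separates H ->
  (forall a b c, a ∈ H -> b ∈ H -> c ∈ H -> a ∈ b -> b ∈ c -> Δ a b ∈ Δ b c) ->
  a ∈ H -> b ∈ H -> a ∈ b -> Δ a b = Δ a (nx a) /\ Δ a (nx a) ∈ Δ b (nx b).
Proof.
  intros OH Nx S Inc Ha Hb Hab.
  assert (Far : forall b c, b ∈ H -> c ∈ H -> a ∈ b -> b ∈ c -> Δ a c = Δ a b).
  { intros x y Hx Hy Hax Hxy; destruct (S a x Ha Hx Hax) as [u Hu].
    destruct (S x y Hx Hy Hxy) as [w Hw].
    apply (first_difference_trans a x y u w); auto. }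
  destruct (Nx a Ha) as [N1 N2], (Nx b Hb) as [N3 N4].
  assert (E : Δ a b = Δ a (nx a)).
  { destruct (ordinal_trichotomy b (nx a)) as [L|[<-|L]]; auto.
    symmetry; auto. }
  split; auto; rewrite <- E; auto.
Qed.

End Difference.

(** * Ramsey cardinals are strong limits *)

Section Ramsey.
Context (θ : V) (Ram : ramsey θ).

Let Cθ : is_cardinal θ := proj1 Ram.
Let Oθ : ordinal θ := proj1 Cθ.
Let Iθ : infinite θ := proj1 (proj2 Ram).
Let Rθ : regular θ := ramsey_regular θ Ram.

Lemma ramsey_num n : num n ∈ θ.
Proof. exact (num_mem_infinite θ Cθ Iθ n). Qed.

Lemma ramsey_succ β : β ∈ θ -> succ β ∈ θ.
Proof. exact (infinite_cardinal_succ θ Cθ Iθ β). Qed.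

Lemma next_exists H : H ⊆ θ -> unbounded θ H ->
  exists nx : V -> V, forall h, h ∈ H -> nx h ∈ H /\ h ∈ nx h.
Proof.
  intros Hs U; destruct (choice (fun h k => h ∈ H -> k ∈ H /\ h ∈ k)) as [nx Hnx]; eauto.
  intros h; destruct (classic (h ∈ H)) as [Hh|Hh]; [|now exists h].
  destruct (U h (Hs _ Hh)) as [k Hk L]; now exists k.
Qed.

Lemma not_small X (e : V -> X) : small θ X -> ~ (forall i j : V, i ∈ θ -> j ∈ θ -> e i = e j -> i = j).
Proof.
  intros [β Hβ (f & Hf & Inj)] He.
  apply (cardinal_no_injection θ β (fun i => f (e i)) Cθ Hβ); auto.
Qed.

(** Otherwise [θ] injects into the subsets of some [X] that injects into some
    [β < θ].  Colour triples by whether first differences move up.  If they do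
    on a homogeneous set, they inject it into [β]; if not, three subsets first
    differ pairwise at one point. *)
Lemma small_power X : small θ X -> small θ (X -> Prop).
Proof.
  intros SX; destruct (enumeration θ Oθ (X -> Prop) (inhabits (fun _ => True)))
    as [[T Inj]|[ζ Hζ (e & _ & Surj)]].
  2:{ exists ζ; auto; destruct (choice (fun P i => i ∈ ζ /\ e i = P)) as [g Hg].
      { intros P; destruct (Surj P) as [i Hi E]; eauto. }
      exists g; split; [apply Hg|intros P Q E].
      destruct (Hg P) as [_ <-], (Hg Q) as [_ <-]; now rewrite E. }
  exfalso; assert (SX' := SX); destruct SX' as [β Hβ (f & Hf & fInj)].
  assert (Of : forall x, ordinal (f x)).
  { intros x; exact (ordinal_mem _ _ (ordinal_mem _ _ Oθ Hβ) (Hf x)). }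
  pose (Δ := first_difference X f T).
  destruct (ramsey_homogeneous θ (fun _ l => match l with
      [a; b; c] => Δ a b ∈ Δ b c | _ => True end) Ram) as (H & Hs & _ & U & Hom); specialize (Hom 0).
  destruct (next_exists H Hs U) as [nx Hnx].
  assert (OH : forall x, x ∈ H -> ordinal x) by (intros x Hx; exact (ordinal_mem _ _ Oθ (Hs _ Hx))).
  assert (Sep : separates X T H).
  { intros a b Ha Hb Hab; apply NNPP; intros N.
    assert (E : a = b).
    { apply Inj; auto; apply functional_extensionality; intros x.
      apply propositional_extensionality, NNPP; intros N'; apply N; eauto. }
    subst b; exact (mem_irrefl _ Hab). }
  destruct (U (num 0) (ramsey_num 0)) as [h0 Hh0 _].
  destruct (Hnx h0 Hh0) as [Hh1 L0].
  destruct (classic (exists a b c, a ∈ H /\ b ∈ H /\ c ∈ H /\ a ∈ b /\ b ∈ c /\ Δ a b ∈ Δ b c))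
    as [(a & b & c & Ha & Hb & Hc & Hab & Hbc & L)|N].
  - assert (Inc : forall a b c, a ∈ H -> b ∈ H -> c ∈ H -> a ∈ b -> b ∈ c -> Δ a b ∈ Δ b c).
    { intros a' b' c' Ha' Hb' Hc' Hab' Hbc'.
      exact (proj1 (Hom [a; b; c] [a'; b'; c'] ltac:(apply (increasing3 θ); auto)
        ltac:(apply (increasing3 θ); auto) eq_refl) L). }
    destruct (choice (fun a x => a ∈ H -> f x = Δ a (nx a))) as [τ Hτ].
    { intros x; destruct (classic (x ∈ H)) as [Hx|Hx].
      - destruct (Hnx x Hx) as [n1 n2]; destruct (Sep x (nx x) Hx n1 n2) as [y Hy].
        destruct (first_differenceP X f T _ _ _ Hy) as [(z & E & _) _]; eauto.
      - destruct (Sep h0 (nx h0) Hh0 Hh1 L0) as [y _]; exists y; easy. }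
    destruct (pigeonhole θ Oθ Rθ (ramsey_num 0) X τ H U Hs SX) as [x Hx].
    destruct (Hx (num 0) (ramsey_num 0)) as (p & Hp & _ & Ep).
    destruct (Hx p (Hs _ Hp)) as (q & Hq & Hpq & Eq).
    destruct (first_difference_increasing X f T Of H nx p q OH Hnx Sep Inc Hp Hq Hpq) as [_ L'].
    fold Δ in L'; rewrite <- Hτ, <- Hτ, Ep, Eq in L' by auto; exact (mem_irrefl _ L').
  - destruct (first_difference_stable X f T Of H h0 (nx h0) Hh0 Hh1 L0 Sep)
      as (m & b & Hb & _ & Hm).
    { intros a b c Ha Hb Hc Hab Hbc L; apply N; exists a, b, c; auto 10. }
    (* three subsets cannot pairwise differ at one point: take consecutive [c d e] *)
    pose (c := nx b); pose (d := nx c); pose (e := nx d).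
    destruct (Hnx b Hb) as [c1 c2]; fold c in c1, c2.
    destruct (Hnx c c1) as [d1 d2]; fold d in d1, d2.
    destruct (Hnx d d1) as [e1 e2]; fold e in e1, e2.
    assert (d3 : b ∈ d) by (eapply ordinal_trans; eauto).
    assert (e3 : c ∈ e) by (eapply ordinal_trans; eauto).
    assert (W : forall p q, p ∈ H -> q ∈ H -> b ∈ p -> p ∈ q ->
      exists x, f x = m /\ ~ (T p x <-> T q x)).
    { intros p q Hp Hq Lp Lq; destruct (Sep p q Hp Hq Lq) as [x Hx].
      destruct (first_differenceP X f T _ _ _ Hx) as [(y & E & Ny) _].
      exists y; split; auto; rewrite E; apply Hm; auto. }
    destruct (W c d) as (x & Ex & Nx); auto.
    destruct (W d e) as (y & Ey & Ny); auto.
    destruct (W c e) as (z & Ez & Nz); auto.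
    assert (y = x) as -> by (apply fInj; congruence).
    assert (z = x) as -> by (apply fInj; congruence).
    destruct (classic (T c x)), (classic (T d x)), (classic (T e x)); tauto.
Qed.

Lemma small_sum X Y : small θ X -> small θ Y -> small θ (X + Y).
Proof.
  intros SX [β Hβ (g & Hg & gI)]; destruct SX as [α Hα (f & Hf & fI)].
  assert (M : exists γ, γ ∈ θ /\ (forall x, f x ∈ γ) /\ (forall y, g y ∈ γ)).
  { destruct (classic (α ∈ β)) as [L|L].
    - exists β; split; [auto|split; auto]; intros x.
      exact (ordinal_trans _ _ _ (ordinal_mem _ _ Oθ Hβ) (Hf x) L).
    - exists α; split; [auto|split; auto]; intros y.
      apply (ordinal_mem_not_mem β); auto; eapply ordinal_mem; eauto. }
  destruct M as (γ & Hγ & Hfγ & Hgγ).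
  pose (F x := exist (fun z => z ∈ γ) (f x) (Hfγ x)).
  pose (G y := exist (fun z => z ∈ γ) (g y) (Hgγ y)).
  apply (small_injection θ _ (({z | z ∈ γ} -> Prop) -> Prop)
    (fun s S => match s with inl x => S (F x) | inr y => ~ S (G y) end)).
  { now apply small_power, small_power, small_mems. }
  intros [x|y] [x'|y'] E.
  - f_equal; apply fI; apply (f_equal (fun P => P (eq (F x)))) in E.
    assert (E' : F x = F x') by (rewrite <- E; reflexivity); now injection E'.
  - exfalso; apply (f_equal (fun P => P (fun _ => False))) in E; rewrite E; auto.
  - exfalso; apply (f_equal (fun P => P (fun _ => False))) in E; rewrite <- E; auto.
  - f_equal; apply gI; apply (f_equal (fun P => P (eq (G y)))) in E.
    assert (E' : G y = G y') by (apply NNPP; rewrite <- E; auto); now injection E'.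
Qed.

Lemma small_prod X Y : small θ X -> small θ Y -> small θ (X * Y).
Proof.
  intros SX SY; apply (small_injection θ _ (X + Y -> Prop)
    (fun p z => match z with inl x => fst p = x | inr y => snd p = y end)).
  { apply small_power, small_sum; auto. }
  intros [x y] [x' y'] E; simpl in E; f_equal.
  - apply (f_equal (fun P => P (inl x'))) in E; now rewrite E.
  - apply (f_equal (fun P => P (inr y'))) in E; now rewrite E.
Qed.

Lemma small_fun X Y : small θ X -> small θ Y -> small θ (X -> Y).
Proof.
  intros SX SY; apply (small_injection θ _ (X * Y -> Prop) (fun f p => f (fst p) = snd p)).
  { apply small_power, small_prod; auto. }
  intros f g E; apply functional_extensionality; intros x.
  apply (f_equal (fun P => P (x, g x))) in E; simpl in E; now rewrite E.
Qed.

Lemma small_nat : small θ nat.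
Proof.
  exists omega; [exact (ramsey_omega θ Ram)|]; exists num; split; [|apply num_inj].
  intros n; apply mem_omega; eauto.
Qed.

Lemma small_option X : small θ X -> small θ (option X).
Proof.
  intros SX; apply (small_injection θ _ (X + nat)
    (fun o => match o with Some x => inl x | None => inr 0 end)).
  - apply small_sum; auto; apply small_nat.
  - intros [x|] [y|] E; congruence.
Qed.

Lemma small_list X : small θ X -> small θ (list X).
Proof.
  intros SX; apply (small_injection θ _ (nat -> option X) (@nth_error X)).
  - apply small_fun, small_option; auto; apply small_nat.
  - intros l m E; apply nth_error_ext; intros n; now rewrite E.
Qed.

(** By induction on [β]: a set of rank [ξ < β] is determined by [ξ] and by the
    image of its elements under an injection of [R ξ] into a bound [γ < θ],
    common to all [ξ] by regularity. *)
Lemma small_R β : β ∈ θ -> small θ {x | x ∈ R β}.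
Proof.
  induction β as [β IH] using (well_founded_ind mem_wf); intros Hβ.
  assert (Oβ := ordinal_mem _ _ Oθ Hβ).
  destruct (choice (fun ξ (p : V * (V -> V)) => ξ ∈ β -> fst p ∈ θ /\
     (forall y, y ∈ R ξ -> snd p y ∈ fst p) /\
     forall y z, y ∈ R ξ -> z ∈ R ξ -> snd p y = snd p z -> y = z)) as [F HF].
  { intros ξ; destruct (classic (ξ ∈ β)) as [Hξ|N]; [|now exists (ξ, fun x => x)].
    destruct (IH ξ Hξ (ordinal_trans _ _ _ Oθ Hξ Hβ)) as [γ Hγ (f & Hf & Inj)].
    pose (g y := epsilon (inhabits y) (fun z => exists h : y ∈ R ξ, z = f (exist _ y h))).
    assert (Hg : forall y (h : y ∈ R ξ), g y = f (exist _ y h)).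
    { intros y h; destruct (epsilon_spec (inhabits y)
        (fun z => exists h : y ∈ R ξ, z = f (exist _ y h))) as [h' E].
      { now exists (f (exist _ y h)), h. }
      fold (g y) in E; rewrite E; f_equal; f_equal; apply proof_irrelevance. }
    exists (γ, g); intros _; simpl; split; [auto|split].
    - intros y Hy; rewrite (Hg y Hy); auto.
    - intros y z Hy Hz; rewrite (Hg y Hy), (Hg z Hz); intros E; apply Inj in E; now injection E. }
  destruct (small_bounded θ Rθ (ramsey_num 0) {ξ | ξ ∈ β} (fun ξ => fst (F (proj1_sig ξ))))
    as [γ Hγ Hb].
  { now apply small_mems. }
  { intros [ξ Hξ]; now apply HF. }
  assert (rkβ : forall x, x ∈ R β -> rank x ∈ β) by (intros x; apply mem_R).
  assert (Oγ := ordinal_mem _ _ Oθ Hγ).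
  assert (HFγ : forall x y, x ∈ R β -> y ∈ x -> y ∈ R (rank x) /\ snd (F (rank x)) y ∈ γ).
  { intros x y Hx Hy; assert (Hr := rkβ x Hx).
    assert (Hy' : y ∈ R (rank x)) by (apply mem_R, rank_mem, Hy); split; auto.
    apply (ordinal_trans _ (fst (F (rank x)))); auto; [now apply HF|].
    exact (Hb (exist (fun ξ => ξ ∈ β) (rank x) Hr)). }
  apply (small_injection θ _ ({ξ | ξ ∈ β} * ({z | z ∈ γ} -> Prop))
    (fun x => (exist (fun ξ => ξ ∈ β) (rank (proj1_sig x)) (rkβ _ (proj2_sig x)),
       fun z => exists2 y, y ∈ proj1_sig x & snd (F (rank (proj1_sig x))) y = proj1_sig z))).
  { apply small_prod; [|apply small_power]; now apply small_mems. }
  assert (Sub : forall x x', x ∈ R β -> x' ∈ R β -> rank x = rank x' ->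
    (forall z : {z | z ∈ γ}, (exists2 y, y ∈ x & snd (F (rank x)) y = proj1_sig z) ->
      exists2 y, y ∈ x' & snd (F (rank x')) y = proj1_sig z) -> x ⊆ x').
  { intros x x' Hx Hx' Er P y Hy; destruct (HFγ x y Hx Hy) as [h1 h2].
    destruct (P (exist (fun z => z ∈ γ) _ h2)) as [y' Hy' E]; [simpl; eauto|simpl in E].
    destruct (HFγ x' y' Hx' Hy') as [h1' _].
    rewrite <- Er in E, h1'; apply (HF (rank x) (rkβ x Hx)) in E; auto; now subst. }
  intros [x Hx] [x' Hx'] E; injection E as Er E.
  assert (Ex : x = x').
  { apply set_ext; intros y; split; apply Sub; simpl in *; auto; intros z;
    apply (f_equal (fun P => P z)) in E; [rewrite <- E|rewrite E]; auto. }
  subst x'; f_equal; apply proof_irrelevance.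
Qed.

Lemma ramsey_strong_limit : strong_limit θ.
Proof.
  intros β Hβ.
  assert (S : small θ {x | x ⊆ β}).
  { apply (small_injection θ _ ({z | z ∈ β} -> Prop) (fun x z => proj1_sig z ∈ proj1_sig x)).
    - now apply small_power, small_mems.
    - intros [x Hx] [y Hy] E; simpl in E.
      assert (Exy : x = y).
      { apply set_ext; intros z; split; intros Hz.
        - apply (f_equal (fun P => P (exist (fun z => z ∈ β) z (Hx z Hz)))) in E; simpl in E; now rewrite <- E.
        - apply (f_equal (fun P => P (exist (fun z => z ∈ β) z (Hy z Hz)))) in E; simpl in E; now rewrite E. }
      subst y; f_equal; apply proof_irrelevance. }
  destruct (enumeration θ Oθ {x | x ⊆ β} (inhabits (exist _ β (fun _ h => h))))
    as [[e Inj]|[ζ Hζ (e & Inj & Surj)]].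
  - destruct (not_small _ e S Inj).
  - exists ζ; auto; destruct (choice (fun x i => x ⊆ β -> i ∈ ζ /\ proj1_sig (e i) = x)) as [g Hg].
    { intros x; destruct (classic (x ⊆ β)) as [Hx|N]; [|now exists x].
      destruct (Surj (exist _ x Hx)) as [i Hi E]; exists i; now rewrite E. }
    exists g; split; [apply Hg|split].
    + intros x y Hx Hy E; destruct (Hg x Hx) as [_ <-], (Hg y Hy) as [_ <-]; now rewrite E.
    + intros i Hi; exists (proj1_sig (e i)); [exact (proj2_sig (e i))|].
      destruct (Hg _ (proj2_sig (e i))) as [h E]; apply Inj; auto.
      apply eq_sig_hprop; [intros; apply proof_irrelevance|exact E].
Qed.

End Ramsey.

(** * Coherent sequences of predicates *)

Section Coherence.
Context (θ : V) (Ram : ramsey θ).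
Context (X : Type) (rk : X -> V) (T : V -> X -> Prop).
Context (Ork : forall x, ordinal (rk x)).
Context (Srk : forall ρ, ρ ∈ θ -> small θ {x | rk x ∈ ρ}).

Let Oθ : ordinal θ := proj1 (proj1 Ram).
Notation Δ := (first_difference X rk T).

(** Meant for [a ∈ b], when [T a] is a predicate on data of rank below [a]. *)
Definition coherent a b : Prop := forall x, rk x ∈ a -> (T a x <-> T b x).

Definition pair_or_triple_colour (l : list V) : Prop :=
  match l with
  | [a; b] => coherent a b
  | [a; b; c] => Δ a b ∈ Δ b c
  | _ => True
  end.

(** Iterating this map pulls a colouring back along first differences: a list
    loses its last element, with which the others are compared. *)
Definition differences (l : list V) : list V :=
  map (fun a => Δ a (last l a)) (removelast l).

Lemma differences_snoc l e : differences (l ++ [e]) = map (fun a => Δ a e) l.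
Proof.
  unfold differences; rewrite removelast_last; apply map_ext; intros a.
  now rewrite last_last.
Qed.

(** Homogeneity for all the pullbacks is what makes the set of first differences
    again homogeneous. *)
Definition difference_homogeneous (H : V) : Prop :=
  forall k, homogeneous H (fun l => pair_or_triple_colour (Nat.iter k differences l)).

Lemma incoherent_difference a b : ordinal a -> ~ coherent a b -> Δ a b ∈ a.
Proof.
  intros Oa N; apply not_all_ex_not in N as [x N].
  apply imply_to_and in N as [Hx N].
  destruct (first_differenceP X rk T a b x N) as [(y & E & _) A].
  rewrite <- E in *; destruct (ordinal_trichotomy (rk x) (rk y)) as [L|[L|L]]; auto.
  - destruct (N (A x L)).
  - now rewrite <- L.
  - exact (ordinal_trans _ _ _ Oa L Hx).
Qed.

(** The map [h -> Δ h (nx h)] is increasing and regressive on [H], and every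
    increasing list in its range is [differences] of an increasing list in [H],
    obtained by adding a large last element.  So colourings of the range are
    colourings of [H] pulled back once more. *)
Lemma difference_set H (nx : V -> V) :
  H ⊆ θ -> unbounded θ H -> difference_homogeneous H ->
  (forall h, h ∈ H -> nx h ∈ H /\ h ∈ nx h) ->
  (forall a b, a ∈ H -> b ∈ H -> a ∈ b -> ~ coherent a b) ->
  (forall a b c, a ∈ H -> b ∈ H -> c ∈ H -> a ∈ b -> b ∈ c -> Δ a b ∈ Δ b c) ->
  exists H', H' ⊆ θ /\ unbounded θ H' /\ difference_homogeneous H' /\
    forall h, h ∈ H -> Δ h (nx h) ∈ H' /\ Δ h (nx h) ∈ h.
Proof.
  intros Hs U Hom Nx Inco Inc.
  assert (OH : forall x, x ∈ H -> ordinal x) by (intros x Hx; exact (ordinal_mem _ _ Oθ (Hs _ Hx))).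
  assert (Sep : separates X T H).
  { intros a b Ha Hb Hab; apply NNPP; intros N; apply (Inco a b Ha Hb Hab).
    intros x _; apply NNPP; intros N'; eauto. }
  pose (d h := Δ h (nx h)).
  assert (dlt : forall h, h ∈ H -> d h ∈ h).
  { intros h Hh; destruct (Nx h Hh); apply incoherent_difference; auto. }
  assert (dmono : forall a b, a ∈ H -> b ∈ H -> a ∈ b -> Δ a b = d a /\ d a ∈ d b).
  { intros a b Ha Hb Hab; exact (first_difference_increasing X rk T Ork H nx a b OH Nx Sep Inc Ha Hb Hab). }
  pose (H' := setof (fun x => exists2 a, a ∈ H & x = d a)).
  assert (MH' : forall x, x ∈ H' <-> exists2 a, a ∈ H & x = d a).
  { apply (mem_setof (fun x => exists2 a, a ∈ H & x = d a)), (is_set_sub _ θ).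
    intros x [a Ha ->]; exact (ordinal_trans _ _ _ Oθ (dlt a Ha) (Hs _ Ha)). }
  assert (H's : H' ⊆ θ).
  { intros x Hx; apply MH' in Hx as [a Ha ->]; exact (ordinal_trans _ _ _ Oθ (dlt a Ha) (Hs _ Ha)). }
  exists H'; split; [auto|split; [|split]].
  - intros β Hβ; apply NNPP; intros N.
    assert (Oβ := ordinal_mem _ _ Oθ Hβ); assert (Hsβ := ramsey_succ θ Ram β Hβ).
    assert (B : forall a, a ∈ H -> d a ∈ succ β).
    { intros a Ha; assert (Hd : d a ∈ H') by (apply MH'; eauto); apply mem_succ.
      destruct (ordinal_trichotomy (d a) β (ordinal_mem _ _ Oθ (H's _ Hd)) Oβ) as [L|[L|L]]; auto.
      exfalso; eauto. }
    destruct (choice (fun a (z : {z | z ∈ succ β}) => a ∈ H -> proj1_sig z = d a)) as [τ Hτ].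
    { intros a; destruct (classic (a ∈ H)) as [Ha|Ha].
      - now exists (exist _ (d a) (B a Ha)).
      - now exists (exist (fun z => z ∈ succ β) β (proj2 (mem_succ β β) (or_intror eq_refl))). }
    destruct (pigeonhole θ Oθ (ramsey_regular θ Ram) (ramsey_num θ Ram 0) _ τ H U Hs
      (small_mems θ _ Hsβ)) as [z Hz].
    destruct (Hz (num 0) (ramsey_num θ Ram 0)) as (p & Hp & _ & Ep).
    destruct (Hz p (Hs _ Hp)) as (q & Hq & Hpq & Eq).
    destruct (dmono p q Hp Hq Hpq) as [_ L].
    rewrite <- Hτ, <- Hτ, Ep, Eq in L by auto; exact (mem_irrefl _ L).
  - assert (Lift : forall l, increasing H' l -> exists l0, increasing H l0 /\ l = map d l0).
    { induction l as [|x l IH]; intros Hl; [exists []; split; auto; apply increasing_nil|].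
      apply increasing_cons in Hl as (Hx & F & Hl); destruct (IH Hl) as (l0 & Hl0 & ->).
      apply MH' in Hx as [a Ha ->]; exists (a :: l0); split; auto.
      apply increasing_cons; split; [auto|split; auto]; intros b Hb.
      assert (Hb' : b ∈ H) by (apply Hl0; auto); assert (L := F _ (in_map d _ _ Hb)).
      destruct (ordinal_trichotomy a b) as [L'|[->|L']]; auto; exfalso.
      - exact (mem_irrefl _ L).
      - exact (mem_asym _ _ L (proj2 (dmono b a Hb' Ha L'))). }
    assert (Lift' : forall l, increasing H' l -> exists m, increasing H m /\
      length m = S (length l) /\ l = differences m).
    { intros l Hl; destruct (Lift l Hl) as (l0 & Hl0 & ->).
      destruct (list_bounded θ (proj1 Ram) (proj1 (proj2 Ram)) l0) as [β Hβ Hb].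
      { intros x Hx; apply Hs, Hl0, Hx. }
      destruct (U β Hβ) as [e He Lβ].
      assert (Le : forall x, In x l0 -> x ∈ e) by
        (intros x Hx; exact (ordinal_trans _ _ _ (OH e He) (Hb x Hx) Lβ)).
      exists (l0 ++ [e]); split; [apply increasing_app; split; [auto|split]|split].
      - apply increasing_cons; split; [auto|split; [intros x []|apply increasing_nil]].
      - intros x y Hx [<-|[]]; auto.
      - rewrite length_app, length_map; simpl; lia.
      - rewrite differences_snoc; apply map_ext_in; intros a Ha; symmetry.
        apply dmono; auto; apply Hl0; auto. }
    intros k l l' Hl Hl' E.
    destruct (Lift' l Hl) as (m & Hm & Lm & ->), (Lift' l' Hl') as (m' & Hm' & Lm' & ->).
    rewrite <- !PeanoNat.Nat.iter_succ_r; apply (Hom (S k)); auto; congruence.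
  - intros h Hh; split; [apply MH'; eauto|exact (dlt h Hh)].
Qed.

(** Ramsey cardinals are almost ineffable.  If pairs of a homogeneous set [H] are
    incoherent, their differences are below the smaller index.  They cannot be
    constant on a final segment of [H], since the predicates restricted to one
    level take fewer than [θ] values.  So they increase, and [difference_set]
    replaces [H] by a homogeneous set with smaller elements: this cannot go on
    forever. *)
Lemma coherent_subsequence :
  exists H, H ⊆ θ /\ unbounded θ H /\
    forall a b, a ∈ H -> b ∈ H -> a ∈ b -> coherent a b.
Proof.
  destruct (ramsey_homogeneous θ (fun k l => pair_or_triple_colour (Nat.iter k differences l)) Ram)
    as (H & Hs & _ & U & Hom).
  destruct (U (num 0) (ramsey_num θ Ram 0)) as [γ Hγ _].
  revert H Hs U Hom Hγ; induction γ as [γ IH] using (well_founded_ind mem_wf).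
  intros H Hs U Hom Hγ.
  destruct (classic (exists a b, a ∈ H /\ b ∈ H /\ a ∈ b /\ coherent a b))
    as [(a & b & Ha & Hb & Hab & C)|Inco].
  { exists H; split; [auto|split; auto]; intros c d Hc Hd Hcd.
    exact (proj1 (Hom 0 [a; b] [c; d] ltac:(apply increasing2; auto)
      ltac:(apply increasing2; auto) eq_refl) C). }
  assert (Inco' : forall a b, a ∈ H -> b ∈ H -> a ∈ b -> ~ coherent a b).
  { intros a b Ha Hb Hab C; apply Inco; exists a, b; auto. }
  destruct (next_exists θ H Hs U) as [nx Nx].
  destruct (classic (exists a b c, a ∈ H /\ b ∈ H /\ c ∈ H /\ a ∈ b /\ b ∈ c /\ Δ a b ∈ Δ b c))
    as [(a & b & c & Ha & Hb & Hc & Hab & Hbc & L)|N].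
  - destruct (difference_set H nx Hs U Hom Nx Inco') as (H' & H's & U' & Hom' & D).
    { intros a' b' c' Ha' Hb' Hc' Hab' Hbc'.
      exact (proj1 (Hom 0 [a; b; c] [a'; b'; c'] ltac:(apply (increasing3 θ); auto)
        ltac:(apply (increasing3 θ); auto) eq_refl) L). }
    destruct (D γ Hγ) as [D1 D2]; exact (IH _ D2 H' H's U' Hom' D1).
  - exfalso.
    assert (Sep : separates X T H).
    { intros a b Ha Hb Hab; apply NNPP; intros N'; apply (Inco' a b Ha Hb Hab).
      intros x _; apply NNPP; intros N''; eauto. }
    destruct (Nx γ Hγ) as [Hγ' Lγ].
    destruct (first_difference_stable X rk T Ork H γ (nx γ) Hγ Hγ' Lγ Sep)
      as (m & b & Hb & Om & Hm).
    { intros x y z Hx Hy Hz Hxy Hyz L; apply N; exists x, y, z; auto 10. }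
    destruct (Nx b Hb) as [c1 c2]; destruct (Nx _ c1) as [d1 d2].
    assert (Mθ : m ∈ θ).
    { rewrite <- (Hm _ _ c1 d1 c2 d2); apply (ordinal_trans _ (nx b)); auto.
      apply incoherent_difference; auto; exact (ordinal_mem _ _ Oθ (Hs _ c1)). }
    pose (τ (h : V) (x : {x | rk x ∈ succ m}) := T h (proj1_sig x)).
    destruct (pigeonhole θ Oθ (ramsey_regular θ Ram) (ramsey_num θ Ram 0) _ τ H U Hs)
      as [P HP].
    { apply (small_power θ Ram), Srk, (ramsey_succ θ Ram), Mθ. }
    destruct (HP b (Hs _ Hb)) as (p & Hp & Hbp & Ep).
    destruct (HP p (Hs _ Hp)) as (q & Hq & Hpq & Eq).
    destruct (Sep p q Hp Hq Hpq) as [x Hx].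
    destruct (first_differenceP X rk T p q x Hx) as [(y & E & Ny) _].
    rewrite (Hm p q Hp Hq Hbp Hpq) in E.
    assert (Hy : rk y ∈ succ m) by (apply mem_succ; auto).
    apply Ny; rewrite <- Eq in Ep; apply (f_equal (fun P => P (exist _ y Hy))) in Ep.
    unfold τ in Ep; simpl in Ep; now rewrite Ep.
Qed.

End Coherence.

(** * Formulas *)

Fixpoint bound (φ : formula) : nat :=
  match φ with
  | fRel i j | fEq i j => S (max i j)
  | fPrd i => S i
  | fNot φ => bound φ
  | fAnd φ ψ => max (bound φ) (bound ψ)
  | fAll φ => pred (bound φ)
  end.

Lemma sat_agree A φ v w :
  (forall n, n < bound φ -> v n = w n) -> (sat A φ v <-> sat A φ w).
Proof.
  revert v w; induction φ as [i j|i j|i|φ IH|φ IHφ ψ IHψ|φ IH]; simpl; intros v w E.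
  - rewrite !E by lia; tauto.
  - rewrite !E by lia; tauto.
  - rewrite E by lia; tauto.
  - rewrite (IH v w E); tauto.
  - rewrite (IHφ v w), (IHψ v w) by (intros; apply E; lia); tauto.
  - assert (H : forall x, sat A φ (scons x v) <-> sat A φ (scons x w)).
    { intros x; apply IH; intros [|n] Hn; simpl; auto; apply E; lia. }
    split; intros F x Hx; apply H; auto.
Qed.

Fixpoint code_formula (φ : formula) : nat :=
  match φ with
  | fRel i j => to_nat (0, to_nat (i, j))
  | fEq i j => to_nat (1, to_nat (i, j))
  | fPrd i => to_nat (2, i)
  | fNot φ => to_nat (3, code_formula φ)
  | fAnd φ ψ => to_nat (4, to_nat (code_formula φ, code_formula ψ))
  | fAll φ => to_nat (5, code_formula φ)
  end.

Lemma to_nat_inj p q : to_nat p = to_nat q -> p = q.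
Proof. intros E; now rewrite <- (cancel_of_to p), E, cancel_of_to. Qed.

Lemma code_formula_inj φ ψ : code_formula φ = code_formula ψ -> φ = ψ.
Proof.
  revert ψ; induction φ as [i j|i j|i|φ IH|φ IHφ φ' IHφ'|φ IH];
  intros [i' j'|i' j'|i'|ψ|ψ ψ'|ψ]; cbn [code_formula]; intros E; apply to_nat_inj in E;
  try discriminate E; apply pair_equal_spec in E as [_ E];
  try (apply to_nat_inj, pair_equal_spec in E as [E1 E2]); f_equal; auto.
Qed.

(** * Reflecting to an inaccessible level *)

Lemma regular_not_onto κ β f : regular κ -> β ∈ κ -> (forall ξ, ξ ∈ β -> f ξ ∈ κ) ->
  exists2 γ, γ ∈ κ & forall ξ, ξ ∈ β -> f ξ <> γ.
Proof.
  intros Reg Hβ Hf; destruct (Reg β f Hβ Hf) as [γ Hγ B]; exists γ; auto.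
  intros ξ Hξ E; apply (mem_irrefl γ); rewrite <- E at 1; auto.
Qed.

(** A bijection with a smaller ordinal, or an injection into [nat], would give
    a cofinal map from a smaller ordinal. *)
Lemma regular_strong_limit_inaccessible κ :
  ordinal κ -> omega ∈ κ -> regular κ -> strong_limit κ -> inaccessible κ.
Proof.
  intros O Hω Reg SL; split; [split; [exact O|]|split; [|split; auto]].
  - intros β Hβ (h & h1 & h2 & h3).
    destruct (choice (fun ξ x => ξ ∈ β -> x ∈ κ /\ h x = ξ)) as [f Hf].
    { intros ξ; destruct (classic (ξ ∈ β)) as [Hξ|N]; [|now exists ξ].
      destruct (h3 ξ Hξ) as [x Hx E]; now exists x. }
    destruct (regular_not_onto κ β f Reg Hβ) as [γ Hγ N]; [apply Hf|].
    destruct (Hf (h γ)) as [f1 f2]; [now apply h1|].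
    apply (N (h γ)); [now apply h1|now apply h2].
  - intros (h & _ & Inj).
    destruct (choice (fun ξ x => x ∈ κ /\ forall y, y ∈ κ -> ξ = num (h y) -> x = y)) as [f Hf].
    { intros ξ; destruct (classic (exists y, y ∈ κ /\ ξ = num (h y))) as [(y & Hy & ->)|N].
      - exists y; split; auto; intros z Hz E; apply num_inj in E; auto.
      - exists omega; split; auto; intros y Hy E; destruct N; eauto. }
    destruct (regular_not_onto κ omega f Reg Hω) as [γ Hγ N]; [intros; apply Hf|].
    apply (N (num (h γ))); [apply mem_omega; eauto|now apply Hf].
Qed.

(** No successor is taken, so that this ordinal is below a nonzero [γ], limit or
    not, exactly when all entries are in [R γ]. *)
Definition max_rank (l : list V) : V :=
  fold_right (fun x m => if excluded_middle_informative (m ∈ rank x) then rank x else m) (num 0) l.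

Lemma ordinal_max_rank l : ordinal (max_rank l).
Proof.
  induction l as [|x l IH]; [apply (ordinal_num 0)|simpl].
  destruct (excluded_middle_informative (max_rank l ∈ rank x)); auto; apply ordinal_rank.
Qed.

Lemma max_rank_mem l γ : ordinal γ -> num 0 ∈ γ ->
  (max_rank l ∈ γ <-> forall x, In x l -> x ∈ R γ).
Proof.
  intros O H0; induction l as [|x l IH]; simpl; [split; auto; intros _ x []|].
  assert (Om := ordinal_max_rank l).
  destruct (excluded_middle_informative (max_rank l ∈ rank x)) as [L|L]; split.
  - intros Hx; assert (Hm := ordinal_trans _ _ _ O L Hx).
    intros y [<-|Hy]; [apply mem_R; auto|apply IH; auto].
  - intros Hl; apply mem_R, Hl; auto.
  - intros Hm y [<-|Hy]; [|apply IH; auto]; apply mem_R.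
    destruct (ordinal_not_mem _ _ Om (ordinal_rank x) L) as [<-|L']; auto.
    exact (ordinal_trans _ _ _ O L' Hm).
  - intros Hl; apply IH; auto.
Qed.

Section Reflection.
Context (θ : V) (Ram : ramsey θ) (Sq : V -> V).

Let Oθ : ordinal θ := proj1 (proj1 Ram).

Definition level (μ : V) : structure := Structure (R μ) mem (elts (Sq μ)).

Definition query : Type := ((formula + nat) * list V)%type.

Definition singularity (μ : V) (p : V * (V -> V)) : Prop :=
  fst p ∈ μ /\ (forall ξ, ξ ∈ fst p -> snd p ξ ∈ μ) /\
  forall γ, γ ∈ μ -> exists2 ξ, ξ ∈ fst p & snd p ξ ∉ γ.

Definition large_power (μ β : V) : Prop :=
  β ∈ μ /\ forall γ, γ ∈ μ -> ~ equipotent (fun x => x ⊆ β) (elts γ).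

(** Besides the truth of formulas in the levels, the queries record reasons for
    a level not to be inaccessible: a cofinal map from a smaller ordinal, and
    the ordinals whose power sets are too large. *)
Definition answer (μ : V) (q : query) : Prop :=
  let w := epsilon (inhabits (μ, fun x => x)) (singularity μ) in
  match q with
  | (inl φ, l) => sat (level μ) φ (fun n => nth n l (num 0))
  | (inr 0, [β]) => singularity μ w /\ β = fst w
  | (inr 1, [ξ; η]) => snd w ξ = η
  | (inr 2, [β]) => large_power μ β
  | _ => True
  end.

Lemma small_queries ρ : ρ ∈ θ -> small θ {q : query | max_rank (snd q) ∈ ρ}.
Proof.
  intros Hρ.
  pose (g x := match excluded_middle_informative (x ∈ R ρ) with
               | left h => Some (exist (fun x => x ∈ R ρ) x h) | right _ => None end).
  assert (gI : forall x y, x ∈ R ρ -> y ∈ R ρ -> g x = g y -> x = y).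
  { intros x y Hx Hy; unfold g.
    destruct (excluded_middle_informative (x ∈ R ρ)), (excluded_middle_informative (y ∈ R ρ));
    try easy; congruence. }
  assert (mI : forall l m, (forall x, In x l -> x ∈ R ρ) -> (forall x, In x m -> x ∈ R ρ) ->
    map g l = map g m -> l = m).
  { induction l as [|x l IH]; intros [|y m] Hl Hm E; try discriminate E; auto.
    simpl in *; injection E as E1 E2; f_equal; auto. }
  apply (small_injection θ _ ((formula + nat) * list (option {x | x ∈ R ρ}))
    (fun q => (fst (proj1_sig q), map g (snd (proj1_sig q))))).
  - apply small_prod; auto; [apply small_sum; auto|].
    + apply (small_injection θ _ nat code_formula); [now apply small_nat|apply code_formula_inj].
    + now apply small_nat.
    + now apply small_list, small_option, small_R.
  - assert (B : forall l, max_rank l ∈ ρ -> forall x, In x l -> x ∈ R ρ).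
    { intros l Hl; apply max_rank_mem; auto; [exact (ordinal_mem _ _ Oθ Hρ)|].
      destruct (ordinal_trichotomy (num 0) ρ (ordinal_num 0) (ordinal_mem _ _ Oθ Hρ)) as [E|[E|E]]; auto.
      - rewrite <- E in Hl; destruct (mem_empty _ Hl).
      - destruct (mem_empty _ E). }
    intros [[k l] Hl] [[k' l'] Hl'] E; simpl in *; injection E as <- E.
    assert (l = l') as <- by (apply mI; eauto).
    f_equal; apply proof_irrelevance.
Qed.

(** Take an unbounded set of levels with coherent answers and let [S] be the
    union of the predicates [Sq a] at these levels.  The levels form an
    elementary chain with union [(R θ, ∈, S)].  They are inaccessible: a level
    with a cofinal map from a smaller ordinal [β] would share this map with
    larger levels, where it is bounded; and the power set of [β] has a size
    below [θ], hence below some larger level. *)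
Lemma ramsey_reflection :
  exists γ S, γ ∈ θ /\ inaccessible γ /\
    forall φ v, (forall n, v n ∈ R γ) ->
      (sat (level γ) φ v <-> sat (Structure (R θ) mem (elts S)) φ v).
Proof.
  destruct (coherent_subsequence θ Ram query (fun q => max_rank (snd q)) answer
    (fun q => ordinal_max_rank (snd q)) small_queries) as (H0 & H0s & U0 & Coh0).
  (* levels above [omega] contain [num 0], the rank of a query without parameters,
     and are uncountable as soon as they are regular *)
  pose (H γ := γ ∈ H0 /\ omega ∈ γ).
  assert (OH : forall γ, H γ -> ordinal γ) by (intros γ [Hγ _]; exact (ordinal_mem _ _ Oθ (H0s _ Hγ))).
  assert (Hθ : forall γ, H γ -> γ ∈ θ) by (intros γ [Hγ _]; auto).
  assert (U : forall β, β ∈ θ -> exists γ, H γ /\ β ∈ γ).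
  { intros β Hβ; destruct (list_bounded θ (proj1 Ram) (proj1 (proj2 Ram)) [β; omega]) as [ζ Hζ B].
    { intros x [<-|[<-|[]]]; auto; now apply ramsey_omega. }
    destruct (U0 ζ Hζ) as [γ Hγ L]; assert (Oγ := ordinal_mem _ _ Oθ (H0s _ Hγ)).
    exists γ; repeat split; auto; apply (ordinal_trans _ ζ); auto; apply B; simpl; auto. }
  assert (Z : forall γ, H γ -> num 0 ∈ γ).
  { intros γ [Hγ L]; apply (ordinal_trans _ omega); auto; [exact (ordinal_mem _ _ Oθ (H0s _ Hγ))|].
    apply mem_omega; eauto. }
  assert (Coh : forall a b k l, H a -> H b -> a ∈ b -> (forall x, In x l -> x ∈ R a) ->
    (answer a (k, l) <-> answer b (k, l))).
  { intros a b k l Ha Hb Hab Hl; apply (Coh0 a b (proj1 Ha) (proj1 Hb) Hab (k, l)).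
    apply max_rank_mem; auto. }
  assert (InR : forall a x, H a -> x ∈ a -> x ∈ R a) by (intros; apply ordinal_in_R; auto).
  assert (Reg : forall γ, H γ -> regular γ).
  { intros γ Hγ β f Hβ Hf; apply NNPP; intros N.
    destruct (U γ (Hθ γ Hγ)) as (δ & Hδ & L).
    pose (w μ := epsilon (inhabits (μ, fun x => x)) (singularity μ)).
    assert (Wγ : singularity γ (w γ)).
    { apply (epsilon_spec (inhabits (γ, fun x => x)) (singularity γ)); exists (β, f).
      split; [auto|split; [auto|]]; simpl; intros ζ Hζ; apply NNPP; intros N'; apply N.
      exists ζ; auto; intros ξ Hξ; apply NNPP; intros N''; eauto. }
    destruct Wγ as (w1 & w2 & w3).
    destruct (proj1 (Coh γ δ (inr 0) [fst (w γ)] Hγ Hδ L ltac:(intros x [<-|[]]; auto)))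
      as [(_ & _ & v3) E].
    { split; auto; split; auto. }
    fold (w δ) in v3, E; destruct (v3 γ L) as [ξ Hξ Nξ]; rewrite <- E in Hξ; apply Nξ.
    assert (Ev : snd (w δ) ξ = snd (w γ) ξ).
    { refine (proj1 (Coh γ δ (inr 1) [ξ; snd (w γ) ξ] Hγ Hδ L _) eq_refl).
      intros x [<-|[<-|[]]]; auto; apply InR; auto.
      exact (ordinal_trans _ _ _ (OH γ Hγ) Hξ w1). }
    rewrite Ev; auto. }
  assert (SL : forall γ, H γ -> strong_limit γ).
  { intros γ Hγ β Hβ; apply NNPP; intros N.
    assert (Hβθ := ordinal_trans _ _ _ Oθ Hβ (Hθ γ Hγ)).
    destruct (ramsey_strong_limit θ Ram β Hβθ) as [ζ Hζ Eq].
    destruct (list_bounded θ (proj1 Ram) (proj1 (proj2 Ram)) [γ; ζ]) as [ξ Hξ B].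
    { intros x [<-|[<-|[]]]; auto. }
    destruct (U ξ Hξ) as (δ & Hδ & L).
    assert (Lγ : γ ∈ δ) by (apply (ordinal_trans _ ξ); auto; apply B; simpl; auto).
    assert (Lζ : ζ ∈ δ) by (apply (ordinal_trans _ ξ); auto; apply B; simpl; auto).
    destruct (proj1 (Coh γ δ (inr 2) [β] Hγ Hδ Lγ ltac:(intros x [<-|[]]; auto))) as [_ P].
    { split; auto; intros α Hα E; apply N; eauto. }
    exact (P ζ Lζ Eq). }
  assert (Elem : forall a b φ v, H a -> H b -> a ∈ b -> (forall n, v n ∈ R a) ->
    (sat (level a) φ v <-> sat (level b) φ v)).
  { intros a b φ v Ha Hb Hab Hv; set (l := map v (seq 0 (bound φ))).
    assert (E : forall n, n < bound φ -> nth n l (num 0) = v n).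
    { intros n Hn; unfold l; rewrite (nth_indep _ (num 0) (v 0)) by (rewrite length_map, length_seq; auto).
      rewrite map_nth, seq_nth; auto. }
    rewrite <- (sat_agree (level a) φ _ v E), <- (sat_agree (level b) φ _ v E).
    apply (Coh a b (inl φ) l); auto; intros x Hx; unfold l in Hx.
    apply in_map_iff in Hx as (n & <- & _); auto. }
  pose (S := setof (fun x => exists a, H a /\ x ∈ R a /\ x ∈ Sq a)).
  assert (MS : forall x, x ∈ S <-> exists a, H a /\ x ∈ R a /\ x ∈ Sq a).
  { apply (mem_setof (fun x => exists a, H a /\ x ∈ R a /\ x ∈ Sq a)), (is_set_sub _ (R θ)).
    intros x (a & Ha & Hx & _); apply (R_mono a); auto. }
  destruct (U _ (ramsey_num θ Ram 0)) as (γ & Hγ & _).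
  exists γ, S; split; [auto|split].
  - apply regular_strong_limit_inaccessible; auto; apply Hγ.
  - intros φ; revert γ Hγ.
    induction φ as [i j|i j|i|φ IH|φ IHφ ψ IHψ|φ IH]; simpl; intros γ Hγ v Hv.
    + tauto.
    + tauto.
    + unfold elts; rewrite MS; split; [intros Hx; exists γ; auto|].
      intros (a & Ha & Hxa & HS).
      destruct (ordinal_trichotomy a γ (OH a Ha) (OH γ Hγ)) as [L|[<-|L]]; auto.
      * apply (Elem a γ (fPrd 0) (fun _ => v i)); auto.
      * apply (Elem γ a (fPrd 0) (fun _ => v i)); auto.
    + rewrite (IH γ Hγ v Hv); tauto.
    + rewrite (IHφ γ Hγ v Hv), (IHψ γ Hγ v Hv); tauto.
    + split; intros F x Hx.
      * destruct (list_bounded θ (proj1 Ram) (proj1 (proj2 Ram)) [γ; rank x]) as [ξ Hξ B].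
        { apply mem_R in Hx; intros y [<-|[<-|[]]]; auto. }
        destruct (U ξ Hξ) as (δ & Hδ & L).
        assert (Lγ : γ ∈ δ) by (apply (ordinal_trans _ ξ); auto; apply B; simpl; auto).
        assert (Hxδ : x ∈ R δ).
        { apply mem_R, (ordinal_trans _ ξ); auto; apply B; simpl; auto. }
        apply (Elem γ δ (fAll φ) v Hγ Hδ Lγ Hv) in F.
        apply (IH δ Hδ); [|apply F, Hxδ]; intros [|n]; simpl; auto.
        apply (R_mono γ); auto.
      * apply (IH γ Hγ); [intros [|n]; simpl; auto|].
        apply F, (R_mono γ); auto.
Qed.

End Reflection.

(** * Heights of well-founded elementary extensions *)

Definition fImp (φ ψ : formula) : formula := fNot (fAnd φ (fNot ψ)).

Definition fTransitive (k : nat) : formula :=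
  fAll (fAll (fImp (fRel 1 (2 + k)) (fImp (fRel 0 1) (fRel 0 (2 + k))))).

Definition fOrdinal (k : nat) : formula :=
  fAnd (fTransitive k) (fAll (fImp (fRel 0 (S k)) (fTransitive 0))).

Definition fComparable : formula :=
  fNot (fAnd (fNot (fRel 0 1)) (fAnd (fNot (fEq 0 1)) (fNot (fRel 1 0)))).

Lemma sat_fImp A φ ψ v : sat A (fImp φ ψ) v <-> (sat A φ v -> sat A ψ v).
Proof. simpl; destruct (classic (sat A ψ v)); tauto. Qed.

Lemma sat_fTransitive A k v : sat A (fTransitive k) v <-> transitive_in A (v k).
Proof.
  unfold fTransitive, transitive_in; cbn [sat]; split.
  - intros H y z Hy Hz H1 H2; specialize (H y Hy z Hz).
    rewrite !sat_fImp in H; exact (H H1 H2).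
  - intros H y Hy z Hz; rewrite !sat_fImp; exact (H y z Hy Hz).
Qed.

Lemma sat_fOrdinal A k v : v k ∈ dom A -> (sat A (fOrdinal k) v <-> ordinal_in A (v k)).
Proof.
  intros Hv; unfold fOrdinal, ordinal_in; cbn [sat]; rewrite sat_fTransitive.
  assert (E : (forall x, x ∈ dom A -> sat A (fImp (fRel 0 (S k)) (fTransitive 0)) (scons x v)) <->
    (forall y, y ∈ dom A -> rel A y (v k) -> transitive_in A y)).
  { split; intros H y Hy; specialize (H y Hy); rewrite sat_fImp, sat_fTransitive in *; exact H. }
  rewrite E; tauto.
Qed.

Lemma ordinal_in_R_iff κ P x : ordinal κ ->
  (ordinal_in (Structure (R κ) mem P) x <-> x ∈ R κ /\ ordinal x).
Proof.
  intros O; split.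
  - intros (Hx & T1 & T2); simpl in *; split; auto; split.
    + intros y Hy z Hz; assert (Hy' := R_transitive _ _ _ O Hy Hx).
      exact (T1 y z Hy' (R_transitive _ _ _ O Hz Hy') Hy Hz).
    + intros w Hw y Hy z Hz; assert (Hw' := R_transitive _ _ _ O Hw Hx).
      assert (Hy' := R_transitive _ _ _ O Hy Hw').
      exact (T2 w Hw' Hw y z Hy' (R_transitive _ _ _ O Hz Hy') Hy Hz).
  - intros (Hx & T1 & T2); split; [auto|split].
    + intros y z _ _ Hy Hz; exact (T1 y Hy z Hz).
    + intros w _ Hw y z _ _ Hy Hz; exact (T2 w Hw y Hy z Hz).
Qed.

Lemma is_set_map a (F : V -> V) : is_set (fun x => exists2 y, y ∈ a & x = F y).
Proof.
  apply (is_set_bigcup a (fun y x => x = F y)); intros y _.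
  apply (is_set_sub _ (succ (F y))); intros x ->; apply mem_succ; auto.
Qed.

Section Height.
Context (κ : V) (P : V -> Prop) (M : structure).
Context (Oκ : ordinal κ) (Zκ : num 0 ∈ κ).
Context (Ext : elementary_extension (Structure (R κ) mem P) M).
Context (Wf : wellfounded_structure M).

(** This is first-order, so it transfers from [R κ], where it holds of true
    ordinals. *)
Lemma ordinal_in_trichotomy x y : ordinal_in M x -> ordinal_in M y ->
  rel M x y \/ x = y \/ rel M y x.
Proof.
  intros Ox Oy; destruct Ext as [_ E].
  pose (φ := fAll (fAll (fImp (fOrdinal 0) (fImp (fOrdinal 1) fComparable)))).
  assert (S : sat M φ (fun _ => num 0)).
  { apply E; [intros _; simpl; apply ordinal_in_R; auto|].
    intros a Ha b Hb; rewrite !sat_fImp, !sat_fOrdinal by auto; simpl scons.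
    rewrite !ordinal_in_R_iff by auto; intros [_ Ob] [_ Oa]; simpl.
    assert (T := ordinal_trichotomy a b Oa Ob); destruct T as [T|[T|T]]; intuition congruence. }
  specialize (S y (proj1 Oy) x (proj1 Ox)).
  rewrite !sat_fImp, !sat_fOrdinal in S by (apply Ox || apply Oy).
  specialize (S Ox Oy); simpl in S.
  apply NNPP; tauto.
Qed.

Lemma ordinal_in_rel x y : ordinal_in M x -> y ∈ dom M -> rel M y x -> ordinal_in M y.
Proof.
  intros (Hx & T1 & T2) Hy Hyx; split; [auto|split; auto].
  intros z Hz Hzy; apply T2; auto; exact (T1 y z Hy Hz Hyx Hzy).
Qed.

(** The Mostowski collapse of the well-founded structure [M]. *)
Definition collapse : V -> V :=
  Fix Wf (fun _ => V) (fun x rec =>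
    setof (fun z => exists y (h : y ∈ dom M /\ x ∈ dom M /\ rel M y x), z = rec y h)).

Lemma mem_collapse x z : x ∈ dom M ->
  (z ∈ collapse x <-> exists y, y ∈ dom M /\ rel M y x /\ z = collapse y).
Proof.
  intros Hx; unfold collapse at 1; rewrite Fix_eq.
  2:{ intros u f g Hfg; f_equal; apply functional_extensionality; intros w.
      apply propositional_extensionality; split; intros (y & h & Hy);
      exists y, h; [rewrite <- Hfg|rewrite Hfg]; exact Hy. }
  fold collapse; rewrite mem_setof.
  - split; [intros (y & (h & _ & h') & E)|intros (y & h & h' & E)]; eauto.
  - destruct (is_set_map (dom M) collapse) as [b Hb]; apply (is_set_sub _ b).
    intros w (y & (h & _) & E); apply Hb; eauto.
Qed.

Lemma ordinal_collapse x : ordinal_in M x -> ordinal (collapse x).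
Proof.
  induction x as [x IH] using (well_founded_ind Wf); intros Ox.
  assert (Hx := proj1 Ox); apply ordinal_of_mems.
  - intros y Hy z Hz; apply mem_collapse in Hy as (y' & Hy' & Ry & ->); auto.
    apply mem_collapse in Hz as (z' & Hz' & Rz & ->); auto; apply mem_collapse; auto.
    exists z'; split; [auto|split; auto]; exact (proj1 (proj2 Ox) y' z' Hy' Hz' Ry Rz).
  - intros y Hy; apply mem_collapse in Hy as (y' & Hy' & Ry & ->); auto.
    apply IH; auto; exact (ordinal_in_rel x y' Ox Hy' Ry).
Qed.

Lemma collapse_rel x y : ordinal_in M x -> ordinal_in M y ->
  (rel M x y <-> collapse x ∈ collapse y).
Proof.
  assert (Mono : forall x y, ordinal_in M x -> ordinal_in M y -> rel M x y -> collapse x ∈ collapse y).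
  { intros a b Oa Ob H; apply mem_collapse; [apply Ob|]; exists a; split; auto; apply Oa. }
  intros Ox Oy; split; auto; intros H.
  destruct (ordinal_in_trichotomy x y Ox Oy) as [L|[->|L]]; auto; exfalso.
  - exact (mem_irrefl _ H).
  - exact (mem_asym _ _ H (Mono y x Oy Ox L)).
Qed.

(** The height is the set of collapses of the ordinals of [M].  An increasing map
    into well-ordered ordinals never goes down, hence the lower bound for it. *)
Lemma ordinal_height_exists :
  exists2 β, ordinal_height M β & forall Λ e, ordinal Λ ->
    (forall i, i ∈ Λ -> ordinal_in M (e i)) ->
    (forall i j, i ∈ Λ -> j ∈ Λ -> i ∈ j -> rel M (e i) (e j)) -> Λ ⊆ β.
Proof.
  pose (β := setof (fun z => exists x, ordinal_in M x /\ z = collapse x)).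
  assert (Mβ : forall z, z ∈ β <-> exists x, ordinal_in M x /\ z = collapse x).
  { apply (mem_setof (fun z => exists x, ordinal_in M x /\ z = collapse x)).
    destruct (is_set_map (dom M) collapse) as [b Hb]; apply (is_set_sub _ b).
    intros w (x & [Hx _] & E); apply Hb; eauto. }
  assert (Oβ : ordinal β).
  { apply ordinal_of_mems.
    - intros y Hy z Hz; apply Mβ in Hy as (x & Ox & ->).
      apply mem_collapse in Hz as (w & Hw & Rw & ->); [|apply Ox].
      apply Mβ; exists w; split; auto; exact (ordinal_in_rel x w Ox Hw Rw).
    - intros y Hy; apply Mβ in Hy as (x & Ox & ->); now apply ordinal_collapse. }
  exists β.
  - split; auto; exists collapse; split; [|split; [|split]].
    + intros x Ox; apply Mβ; eauto.
    + intros y Hy; apply Mβ in Hy as (x & Ox & ->); eauto.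
    + intros x y Ox Oy E; destruct (ordinal_in_trichotomy x y Ox Oy) as [L|[L|L]]; auto; exfalso;
      apply collapse_rel in L; auto; rewrite E in L; exact (mem_irrefl _ L).
    + intros x y Ox Oy; now apply collapse_rel.
  - intros Λ e OΛ He Hrel.
    assert (L : forall i, i ∈ Λ -> i ⊆ collapse (e i)).
    { induction i as [i IH] using (well_founded_ind mem_wf); intros Hi j Hj.
      assert (HjΛ := ordinal_trans _ _ _ OΛ Hj Hi).
      assert (Hc : collapse (e j) ∈ collapse (e i)) by (apply collapse_rel; auto).
      destruct (ordinal_subset j (collapse (e j))) as [E|E]; auto.
      - exact (ordinal_mem _ _ OΛ HjΛ).
      - apply ordinal_collapse; auto.
      - now rewrite E.
      - exact (ordinal_trans _ _ _ (ordinal_collapse _ (He i Hi)) E Hc). }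
    intros i Hi; assert (Hc : collapse (e i) ∈ β) by (apply Mβ; eauto).
    destruct (ordinal_subset i (collapse (e i))) as [E|E]; auto.
    + exact (ordinal_mem _ _ OΛ Hi).
    + apply ordinal_collapse; auto.
    + now rewrite E.
    + exact (ordinal_trans _ _ _ Oβ E Hc).
Qed.

End Height.

(** * Limited ultrapowers *)

Section LimitedUltrapower.
Context (A : structure) (G N : Type) (D : (G -> Prop) -> Prop) (ev : N -> G -> V).
Context (D_mono : forall X Y : G -> Prop, (forall g, X g -> Y g) -> D X -> D Y).
Context (D_inter : forall X : nat -> G -> Prop, (forall n, D (X n)) -> D (fun g => forall n, X n g)).
Context (D_inhabited : forall X, D X -> exists g, X g).
Context (ev_dom : forall ν, D (fun g => ev ν g ∈ dom A)).
Context (ev_const : forall x, x ∈ dom A -> exists ν, forall g, ev ν g = x).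
Context (decided : forall φ (ν : nat -> N),
  D (fun g => sat A φ (fun n => ev (ν n) g)) \/ D (fun g => ~ sat A φ (fun n => ev (ν n) g))).
Context (skolem_closed : forall φ (ν : nat -> N), exists σ, D (fun g =>
  ~ sat A (fAll φ) (fun n => ev (ν n) g) -> ~ sat A φ (scons (ev σ g) (fun n => ev (ν n) g)))).
Context (enc : N -> V) (enc_inj : forall ν μ, enc ν = enc μ -> ν = μ).
Context (enc_dom : forall ν, enc ν ∉ dom A) (enc_set : is_set (fun x => exists ν, x = enc ν)).

Lemma D_and X Y : D X -> D Y -> D (fun g => X g /\ Y g).
Proof.
  intros HX HY; apply (D_mono (fun g => forall n : nat, match n with 0 => X g | _ => Y g end)).
  - intros g H; exact (conj (H 0) (H 1)).
  - apply (D_inter (fun n g => match n with 0 => X g | _ => Y g end)); intros [|n]; auto.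
Qed.

Lemma D_mono2 X Y Z : (forall g, X g -> Y g -> Z g) -> D X -> D Y -> D Z.
Proof.
  intros H HX HY; apply (D_mono (fun g => X g /\ Y g)); [intros g []; auto|now apply D_and].
Qed.

Definition congruent (ν μ : N) : Prop := D (fun g => ev ν g = ev μ g).

Lemma congruent_ext ν μ : congruent ν μ -> congruent ν = congruent μ.
Proof.
  intros H; apply functional_extensionality; intros ξ; apply propositional_extensionality.
  split; apply D_mono2 with (2 := H); congruence.
Qed.

(** Elements of the ultrapower are classes of names modulo [D].  A class that
    contains a constant is represented by this constant, so that the ultrapower
    literally extends [A]; any other class by the code of a chosen name, which
    lies outside of [dom A]. *)
Definition point (ν : N) : V :=
  epsilon (inhabits (enc ν)) (fun y =>
    (y ∈ dom A /\ D (fun g => ev ν g = y)) \/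
    (~ (exists x, x ∈ dom A /\ D (fun g => ev ν g = x)) /\
     y = enc (epsilon (inhabits ν) (congruent ν)))).

Lemma pointP ν :
  (point ν ∈ dom A /\ D (fun g => ev ν g = point ν)) \/
  (~ (exists x, x ∈ dom A /\ D (fun g => ev ν g = x)) /\
   point ν = enc (epsilon (inhabits ν) (congruent ν))).
Proof.
  apply (epsilon_spec (inhabits (enc ν)) (fun y =>
    (y ∈ dom A /\ D (fun g => ev ν g = y)) \/
    (~ (exists x, x ∈ dom A /\ D (fun g => ev ν g = x)) /\
     y = enc (epsilon (inhabits ν) (congruent ν))))).
  destruct (classic (exists x, x ∈ dom A /\ D (fun g => ev ν g = x))) as [[x Hx]|H]; eauto.
Qed.

Lemma point_const ν x : x ∈ dom A -> D (fun g => ev ν g = x) -> point ν = x.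
Proof.
  intros Hx H; destruct (pointP ν) as [[_ H']|[H' _]]; [|destruct H'; eauto].
  destruct (D_inhabited _ (D_and _ _ H H')) as (g & E & E'); congruence.
Qed.

Lemma point_eq ν μ : point ν = point μ <-> congruent ν μ.
Proof.
  assert (Refl : forall ν, congruent ν (epsilon (inhabits ν) (congruent ν))).
  { intros ξ; apply (epsilon_spec (inhabits ξ) (congruent ξ)); exists ξ.
    destruct (decided (fEq 0 1) (fun _ => ξ)) as [H|H]; [exact H|].
    destruct (D_inhabited _ H) as [g Hg]; now destruct Hg. }
  split; intros H.
  - destruct (pointP ν) as [[H1 H2]|[H1 H2]], (pointP μ) as [[H3 H4]|[H3 H4]].
    + rewrite <- H in H4; unfold congruent; apply D_mono2 with (2 := H2) (3 := H4); congruence.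
    + destruct (enc_dom (epsilon (inhabits μ) (congruent μ))); rewrite <- H4, <- H; auto.
    + destruct (enc_dom (epsilon (inhabits ν) (congruent ν))); rewrite <- H2, H; auto.
    + rewrite H2, H4 in H; apply enc_inj in H.
      assert (R1 := Refl ν); rewrite H in R1; assert (R2 := Refl μ).
      unfold congruent in *; apply D_mono2 with (2 := R1) (3 := R2); congruence.
  - assert (E := congruent_ext ν μ H).
    destruct (pointP μ) as [[H1 H2]|[H1 H2]].
    + apply point_const; auto; apply D_mono2 with (2 := H) (3 := H2); congruence.
    + destruct (pointP ν) as [[H3 H4]|[H3 H4]].
      * destruct H1; exists (point ν); split; auto.
        apply D_mono2 with (2 := H) (3 := H4); congruence.
      * rewrite H2, H4, E; f_equal; apply epsilon_inh_irrelevance.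
        rewrite <- E; eexists; apply Refl.
Qed.

Lemma points_set : is_set (fun x => exists ν, x = point ν).
Proof.
  destruct enc_set as [b Hb].
  destruct (is_set_bigcup (num 2) (fun y x => (y = num 0 /\ x ∈ dom A) \/ (y = num 1 /\ x ∈ b)))
    as [c Hc].
  { intros y Hy; apply mem_num in Hy as [[|[|n]] Hn ->]; [| |lia].
    - apply (is_set_sub _ (dom A)); intros x [[_ H]|[E _]]; auto; apply num_inj in E; lia.
    - apply (is_set_sub _ b); intros x [[E _]|[_ H]]; auto; apply num_inj in E; lia. }
  apply (is_set_sub _ c); intros x [ν ->]; apply Hc.
  destruct (pointP ν) as [[H _]|[_ E]].
  - exists (num 0); [apply num_lt; lia|auto].
  - exists (num 1); [apply num_lt; lia|]; right; split; auto; apply Hb; eauto.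
Qed.

Definition limited_ultrapower : structure := Structure
  (setof (fun x => exists ν, x = point ν))
  (fun x y => exists ν μ, x = point ν /\ y = point μ /\ D (fun g => rel A (ev ν g) (ev μ g)))
  (fun x => exists ν, x = point ν /\ D (fun g => prd A (ev ν g))).

Notation M := limited_ultrapower.

Lemma mem_points x : x ∈ dom M <-> exists ν, x = point ν.
Proof. apply (mem_setof (fun x => exists ν, x = point ν)), points_set. Qed.

Definition ncons (σ : N) (ν : nat -> N) (n : nat) : N := match n with 0 => σ | S n => ν n end.

Lemma scons_point σ ν : scons (point σ) (fun n => point (ν n)) = fun n => point (ncons σ ν n).
Proof. apply functional_extensionality; intros [|n]; reflexivity. Qed.

Lemma scons_ev σ ν g : scons (ev σ g) (fun n => ev (ν n) g) = fun n => ev (ncons σ ν n) g.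
Proof. apply functional_extensionality; intros [|n]; reflexivity. Qed.

(** The theorem of Łoś.  For universal quantifiers, a Skolem function provides a
    name of a counterexample. *)
Lemma los φ (ν : nat -> N) :
  sat M φ (fun n => point (ν n)) <-> D (fun g => sat A φ (fun n => ev (ν n) g)).
Proof.
  revert ν; induction φ as [i j|i j|i|φ IH|φ IHφ ψ IHψ|φ IH]; intros ν; cbn [sat].
  - simpl; split.
    + intros (μ & ξ & E1 & E2 & H); apply point_eq in E1, E2.
      assert (H' := D_and _ _ E1 E2); apply D_mono2 with (2 := H) (3 := H').
      intros g Hg [-> ->]; auto.
    + intros H; exists (ν i), (ν j); auto.
  - apply point_eq.
  - simpl; split.
    + intros (μ & E & H); apply point_eq in E.
      apply D_mono2 with (2 := H) (3 := E); intros g Hg ->; auto.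
    + intros H; exists (ν i); auto.
  - rewrite IH; split.
    + intros H; destruct (decided φ ν); easy.
    + intros H H'; destruct (D_inhabited _ (D_and _ _ H H')) as (g & Hg & Hg'); auto.
  - rewrite IHφ, IHψ; split; [intros []; now apply D_and|].
    intros H; split; apply D_mono with (2 := H); tauto.
  - split.
    + intros H; destruct (decided (fAll φ) ν) as [|H']; auto; exfalso.
      destruct (skolem_closed φ ν) as [σ Hσ].
      assert (Hp := H (point σ) (proj2 (mem_points _) (ex_intro _ σ eq_refl))).
      rewrite scons_point, IH in Hp.
      destruct (D_inhabited _ (D_and _ _ Hp (D_and _ _ H' Hσ))) as (g & g1 & g2 & g3).
      rewrite scons_ev in g3; exact (g3 g2 g1).
    + intros H x Hx; apply mem_points in Hx as [σ ->]; rewrite scons_point; apply IH.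
      apply D_mono2 with (2 := H) (3 := ev_dom σ); intros g Hg Hd.
      rewrite <- scons_ev; auto.
Qed.

Lemma const_point x : x ∈ dom A -> exists2 ν, x = point ν & forall g, ev ν g = x.
Proof.
  intros Hx; destruct (ev_const x Hx) as [ν Hν]; exists ν; auto; symmetry.
  apply point_const; auto; apply (D_mono (fun g => ev ν g ∈ dom A)); auto.
Qed.

Lemma D_true : forall ν : N, D (fun _ => True).
Proof. intros ν; apply D_mono with (2 := ev_dom ν); auto. Qed.

Lemma limited_ultrapower_elementary : elementary_extension A M.
Proof.
  split.
  - intros x Hx; destruct (const_point x Hx) as [ν E _]; apply mem_points; eauto.
  - intros φ v Hv.
    destruct (choice (fun n ν => v n = point ν /\ forall g, ev ν g = v n)) as [ν Hν].
    { intros n; destruct (const_point (v n) (Hv n)); eauto. }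
    assert (E1 : v = fun n => point (ν n)) by (apply functional_extensionality; intros n; apply Hν).
    assert (E2 : forall g, (fun n => ev (ν n) g) = v)
      by (intros g; apply functional_extensionality; intros n; apply Hν).
    rewrite E1 at 2; rewrite los; split; intros H.
    + apply D_mono with (2 := D_true (ν 0)); intros g _; now rewrite E2.
    + destruct (D_inhabited _ H) as [g Hg]; now rewrite E2 in Hg.
Qed.

(** By countable completeness, an infinite descending sequence of classes would
    descend at one single point of [G]. *)
Lemma limited_ultrapower_wf : well_founded (rel A) -> wellfounded_structure M.
Proof.
  intros Wf.
  destruct (classic (inhabited N)) as [[ν0]|Ne].
  2:{ intros x; constructor; intros y (Hy & _); apply mem_points in Hy as [ν _]; now destruct Ne. }
  pose (lt x y := x ∈ dom M /\ y ∈ dom M /\ rel M x y).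
  apply NNPP; intros NW; apply not_all_ex_not in NW as [x0 N0]; fold lt in N0.
  assert (Step : forall x, ~ Acc lt x -> exists y, ~ Acc lt y /\ lt y x).
  { intros x Nx; apply NNPP; intros H; apply Nx; constructor; intros y Hy.
    apply NNPP; intros Ny; apply H; eauto. }
  destruct (choice (fun x y => ~ Acc lt x -> ~ Acc lt y /\ lt y x)) as [f Hf].
  { intros x; destruct (classic (Acc lt x)) as [H|H]; [now exists x|].
    destruct (Step x H) as [y Hy]; eauto. }
  pose (s n := Nat.iter n f x0).
  assert (Ns : forall n, ~ Acc lt (s n)) by (induction n; simpl; auto; now apply Hf).
  assert (Ls : forall n, lt (s (S n)) (s n)) by (intros n; apply Hf, Ns).
  destruct (choice (fun n ν => s n = point ν)) as [ν Hν].
  { intros n; apply mem_points; apply (Ls n). }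
  assert (HD : forall n, D (fun g => rel A (ev (ν (S n)) g) (ev (ν n) g))).
  { intros n; destruct (Ls n) as (_ & _ & Hr); rewrite !Hν in Hr.
    apply (los (fRel 0 1) (fun k => match k with 0 => ν (S n) | _ => ν n end)); exact Hr. }
  destruct (D_inhabited _ (D_inter _ HD)) as [g Hg].
  assert (H : forall x n, x <> ev (ν n) g).
  { induction x as [x IH] using (well_founded_ind Wf); intros n ->.
    exact (IH _ (Hg n) (S n) eq_refl). }
  exact (H _ 0 eq_refl).
Qed.

(** New elements below an old one would be represented by names that are bounded
    by a constant, and these are constant. *)
Lemma limited_ultrapower_end :
  (forall ν x, x ∈ dom A -> D (fun g => rel A (ev ν g) x) ->
    exists2 y, y ∈ dom A & D (fun g => ev ν g = y)) ->
  (exists ν, point ν ∉ dom A) ->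
  end_elementary_extension A M.
Proof.
  intros Reg [ν0 Hν0]; split; [exact limited_ultrapower_elementary|split].
  - intros E; apply Hν0; rewrite E; apply mem_points; eauto.
  - intros a Ha b; destruct (const_point a Ha) as [α Eα Hα].
    assert (Rel : forall ν, rel M (point ν) a <-> D (fun g => rel A (ev ν g) a)).
    { intros ν; rewrite Eα at 1.
      rewrite (los (fRel 0 1) (fun k => match k with 0 => ν | _ => α end)); simpl.
      split; intros H; apply D_mono with (2 := H); intros g; now rewrite Hα. }
    split; intros [Hb Hr].
    + destruct (const_point b Hb) as [β Eβ Hβ]; split; [apply mem_points; eauto|].
      rewrite Eβ; apply Rel; apply D_mono with (2 := D_true β); intros g _; now rewrite Hβ.
    + apply mem_points in Hb as [ν ->]; apply Rel in Hr.
      destruct (Reg ν a Ha Hr) as [y Hy E]; rewrite (point_const ν y Hy E); split; auto.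
      destruct (D_inhabited _ (D_and _ _ E Hr)) as (g & <- & H); auto.
Qed.

End LimitedUltrapower.

(** * Skolem terms and indiscernibles *)

(** Skolem terms, denoting maps from valuations to valuations: [tSkolem] yields a
    constant valuation and [tCons] builds finite tuples.  With [tBranch j], a
    term reads the [j]-th of countably many sequences interleaved in its input,
    so that several terms can share one input. *)
Inductive term : Type :=
| tId
| tBranch (j : nat) (t : term)
| tCons (t e : term)
| tSkolem (φ : formula) (t : term).

Fixpoint code_term (t : term) : nat :=
  match t with
  | tId => to_nat (0, 0)
  | tBranch j t => to_nat (1, to_nat (j, code_term t))
  | tCons t e => to_nat (2, to_nat (code_term t, code_term e))
  | tSkolem φ t => to_nat (3, to_nat (code_formula φ, code_term t))
  end.

Lemma code_term_inj t u : code_term t = code_term u -> t = u.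
Proof.
  revert u; induction t as [|j t IH|t IHt e IHe|φ t IH]; intros [|j' u|u e'|ψ u];
  cbn [code_term]; intros E; apply to_nat_inj in E; try discriminate E; auto;
  apply pair_equal_spec in E as [_ E]; apply to_nat_inj, pair_equal_spec in E as [E1 E2];
  f_equal; auto; now apply code_formula_inj.
Qed.

Definition truncate (k : nat) (v : nat -> V) (n : nat) : V :=
  if Nat.ltb n k then v n else num 0.

Section Terms.
Context (A : structure) (A0 : num 0 ∈ dom A).

(** Truncation makes the value depend on finitely many entries of [v] only. *)
Definition skolem (φ : formula) (v : nat -> V) : V :=
  epsilon (inhabits (num 0)) (fun x => x ∈ dom A /\
    (~ sat A (fAll φ) (truncate (bound (fAll φ)) v) ->
     ~ sat A φ (scons x (truncate (bound (fAll φ)) v)))).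

Lemma skolemP φ v : skolem φ v ∈ dom A /\
  (~ sat A (fAll φ) v -> ~ sat A φ (scons (skolem φ v) v)).
Proof.
  set (w := truncate (bound (fAll φ)) v).
  assert (W : forall n, n < bound (fAll φ) -> w n = v n).
  { intros n Hn; unfold w, truncate; apply PeanoNat.Nat.ltb_lt in Hn; now rewrite Hn. }
  destruct (epsilon_spec (inhabits (num 0)) (fun x => x ∈ dom A /\
    (~ sat A (fAll φ) w -> ~ sat A φ (scons x w)))) as [H1 H2].
  { destruct (classic (exists x, x ∈ dom A /\ ~ sat A φ (scons x w))) as [(x & Hx & H)|N]; eauto.
    exists (num 0); split; auto; intros H; destruct H; intros x Hx; apply NNPP; eauto. }
  fold (skolem φ v) in H1, H2; split; auto.
  rewrite <- (sat_agree A (fAll φ) w v W).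
  rewrite <- (sat_agree A φ (scons (skolem φ v) w) (scons (skolem φ v) v)); auto.
  intros [|n] Hn; simpl; auto; apply W; simpl; lia.
Qed.

Fixpoint denote (t : term) (w : nat -> V) : nat -> V :=
  match t with
  | tId => w
  | tBranch j t => denote t (fun n => w (to_nat (j, n)))
  | tCons t e => scons (denote t w 0) (denote e w)
  | tSkolem φ t => fun _ => skolem φ (denote t w)
  end.

Lemma denote_dom t w : (forall n, w n ∈ dom A) -> forall n, denote t w n ∈ dom A.
Proof.
  revert w; induction t as [|j t IH|t IHt e IHe|φ t IH]; simpl; intros w Hw.
  - exact Hw.
  - exact (IH _ (fun n => Hw (to_nat (j, n)))).
  - intros [|n]; [exact (IHt w Hw 0)|exact (IHe w Hw n)].
  - intros _; apply skolemP.
Qed.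

Lemma bounded_below (f : nat -> nat) N : exists B, forall n, n < N -> f n < B.
Proof.
  induction N as [|N [B HB]]; [exists 0; lia|].
  exists (S (max B (f N))); intros n Hn.
  destruct (PeanoNat.Nat.eq_dec n N) as [->|]; [lia|]; assert (H := HB n); lia.
Qed.

Lemma denote_agree t m : exists N, forall w w',
  (forall n, n < N -> w n = w' n) -> forall n, n < m -> denote t w n = denote t w' n.
Proof.
  revert m; induction t as [|j t IH|t IHt e IHe|φ t IH]; simpl; intros m.
  - exists m; auto.
  - destruct (IH m) as [N HN]; destruct (bounded_below (fun n => to_nat (j, n)) N) as [B HB].
    exists B; intros w w' E; apply HN; intros n Hn; apply E, HB, Hn.
  - destruct (IHt 1) as [N HN], (IHe m) as [N' HN']; exists (max N N'); intros w w' E [|n] Hn; simpl.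
    + apply HN; auto; intros; apply E; lia.
    + apply HN'; [|lia]; intros; apply E; lia.
  - destruct (IH (bound (fAll φ))) as [N HN]; exists N; intros w w' E _ _.
    assert (T : truncate (bound (fAll φ)) (denote t w) = truncate (bound (fAll φ)) (denote t w')).
    { apply functional_extensionality; intros n; unfold truncate.
      destruct (Nat.ltb n (bound (fAll φ))) eqn:L; auto.
      apply HN; auto; now apply PeanoNat.Nat.ltb_lt. }
    unfold skolem; now rewrite T.
Qed.

Lemma sat_denote_agree φ t : exists N, forall w w',
  (forall n, n < N -> w n = w' n) -> (sat A φ (denote t w) <-> sat A φ (denote t w')).
Proof.
  destruct (denote_agree t (bound φ)) as [N HN]; exists N; intros w w' E.
  apply sat_agree; auto.
Qed.

Fixpoint tuple (t : nat -> term) (j m : nat) : term :=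
  match m with
  | 0 => tId
  | S m => tCons (tBranch j (t j)) (tuple t (S j) m)
  end.

Lemma denote_tuple t w m j n : n < m ->
  denote (tuple t j m) w n = denote (t (j + n)) (fun k => w (to_nat (j + n, k))) 0.
Proof.
  revert j n; induction m as [|m IH]; intros j n Hn; [lia|].
  destruct n as [|n]; cbn [tuple denote scons].
  - now rewrite PeanoNat.Nat.add_0_r.
  - rewrite IH by lia; now rewrite <- PeanoNat.Nat.add_succ_comm.
Qed.

End Terms.

Definition mix (x : nat -> V) (π : nat -> option nat) (l : list V) (n : nat) : V :=
  match π n with None => x n | Some m => nth m l (num 0) end.

Section Indiscernibles.
Context (θ : V) (Ram : ramsey θ) (A : structure).

Let Oθ : ordinal θ := proj1 (proj1 Ram).

Lemma small_formula : small θ formula.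
Proof.
  apply (small_injection θ _ nat code_formula); [now apply small_nat|apply code_formula_inj].
Qed.

Lemma small_term : small θ term.
Proof.
  apply (small_injection θ _ nat code_term); [now apply small_nat|apply code_term_inj].
Qed.

Definition same_type (c : V) (l l' : list V) : Prop :=
  forall φ t x π, (forall n : nat, x n ∈ R c) ->
    (sat A φ (denote A t (mix x π l)) <-> sat A φ (denote A t (mix x π l'))).

(** Colour a list made of [c] and two blocks of equal length by whether the
    blocks have the same type over [R c].  There are fewer than [θ] types over
    [R c], so two of [θ] successive blocks have the same type, and this is the
    homogeneous colour.  Two arbitrary blocks above [c] are compared with a
    third block above both. *)
Lemma indiscernibles :
  exists H, H ⊆ θ /\ unbounded θ H /\ forall c l l', c ∈ H ->
    increasing H l -> increasing H l' -> length l = length l' ->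
    (forall x, In x l -> c ∈ x) -> (forall x, In x l' -> c ∈ x) -> same_type c l l'.
Proof.
  destruct (ramsey_homogeneous θ (fun _ l => match l with [] => True | c :: r =>
      same_type c (firstn (Nat.div2 (length r)) r) (skipn (Nat.div2 (length r)) r) end) Ram)
    as (H & Hs & _ & U & Hom); specialize (Hom 0).
  exists H; split; [auto|split; auto].
  assert (OH : forall x, x ∈ H -> ordinal x) by (intros x Hx; exact (ordinal_mem _ _ Oθ (Hs _ Hx))).
  assert (Hom' : forall c l m c' l' m', increasing H (c :: l ++ m) -> increasing H (c' :: l' ++ m') ->
    length m = length l -> length l' = length l -> length m' = length l ->
    same_type c l m -> same_type c' l' m').
  { assert (Half : forall l m : list V, length m = length l -> Nat.div2 (length (l ++ m)) = length l).
    { intros l m E; rewrite length_app, E.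
      replace (length l + length l) with (2 * length l) by lia; apply PeanoNat.Nat.div2_double. }
    assert (Fst : forall l m : list V, firstn (length l) (l ++ m) = l).
    { intros l m; now rewrite firstn_app, firstn_all, PeanoNat.Nat.sub_diag, app_nil_r. }
    assert (Skp : forall l m : list V, skipn (length l) (l ++ m) = m).
    { intros l m; now rewrite skipn_app, skipn_all, PeanoNat.Nat.sub_diag. }
    intros c l m c' l' m' Hl Hl' E1 E2 E3.
    assert (C := Hom _ _ Hl Hl' ltac:(simpl; rewrite !length_app; lia)); cbn beta iota in C.
    rewrite !Half, !Fst, !Skp in C by lia; apply C. }
  assert (Above : forall b n, b ∈ θ -> exists l, increasing H l /\ length l = n /\
    forall x, In x l -> b ∈ x) by (intros; now apply (increasing_above θ)).
  assert (Bd : forall l, increasing H l -> exists2 β, β ∈ θ & forall x, In x l -> x ∈ β).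
  { intros l Hl; apply list_bounded; try apply Ram; intros x Hx; apply Hs, Hl, Hx. }
  assert (Join : forall c l m, c ∈ H -> increasing H l -> increasing H m ->
    (forall x, In x l -> c ∈ x) -> (forall x, In x m -> c ∈ x) ->
    (forall x y, In x l -> In y m -> x ∈ y) -> increasing H (c :: l ++ m)).
  { intros c l m Hc Hl Hm L1 L2 L3; apply increasing_cons; split; [auto|split].
    - intros x Hx; apply in_app_or in Hx as []; auto.
    - apply increasing_app; auto. }
  assert (Same : forall c l m, increasing H (c :: l ++ m) -> length m = length l -> same_type c l m).
  { intros c l m Hl E; apply NNPP; intros N.
    assert (Hc : c ∈ H) by (apply (proj2 Hl); simpl; auto).
    destruct (choice (fun h b => h ∈ H -> increasing H b /\ length b = length l /\
      forall x, In x b -> h ∈ x)) as [b Hb].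
    { intros h; destruct (classic (h ∈ H)) as [Hh|Hh]; [|now exists []].
      destruct (Above h (length l) (Hs _ Hh)) as (b & Hb); now exists b. }
    pose (τ h (q : formula * term * (nat -> {x | x ∈ R c}) * (nat -> option nat)) :=
      let '(φ, t, x, π) := q in sat A φ (denote A t (mix (fun n => proj1_sig (x n)) π (b h)))).
    destruct (pigeonhole θ Oθ (ramsey_regular θ Ram) (ramsey_num θ Ram 0) _ τ H U Hs) as [P HP].
    { apply small_power; auto; apply small_prod; auto; [apply small_prod; auto; [apply small_prod; auto|]|].
      - apply small_formula.
      - apply small_term.
      - apply small_fun; [auto|now apply small_nat|apply small_R; auto].
      - apply small_fun; [auto|now apply small_nat|apply small_option; auto; now apply small_nat]. }
    destruct (HP c (Hs _ Hc)) as (p & Hp & Lp & Ep).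
    destruct (Hb p Hp) as (b1 & b2 & b3); destruct (Bd (b p) b1) as [β Hβ Bβ].
    destruct (list_bounded θ (proj1 Ram) (proj1 (proj2 Ram)) [p; β]) as [ζ Hζ Bζ].
    { intros x [<-|[<-|[]]]; auto. }
    destruct (HP ζ Hζ) as (q & Hq & Lq & Eq).
    destruct (Hb q Hq) as (d1 & d2 & d3).
    assert (Lqβ : β ∈ q) by (apply (ordinal_trans _ ζ); auto; apply Bζ; simpl; auto).
    assert (Lpq : p ∈ q) by (apply (ordinal_trans _ ζ); auto; apply Bζ; simpl; auto).
    assert (Lcq : c ∈ q) by (apply (ordinal_trans _ p); auto).
    apply N; apply (Hom' c (b p) (b q)); auto; try congruence.
    - apply Join; auto.
      + intros x Hx; apply (ordinal_trans _ p); auto; apply OH, b1, Hx.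
      + intros x Hx; apply (ordinal_trans _ q); auto; apply OH, d1, Hx.
      + intros x y Hx Hy; assert (Oy := OH y (proj2 d1 y Hy)).
        apply (ordinal_trans _ q); auto; apply (ordinal_trans _ β); auto.
    - intros φ t x π Hx; rewrite <- Ep in Eq.
      apply (f_equal (fun P => P (φ, t, fun n => exist _ (x n) (Hx n), π))) in Eq.
      change (sat A φ (denote A t (mix x π (b q))) = sat A φ (denote A t (mix x π (b p)))) in Eq.
      now rewrite Eq. }
  intros c l l' Hc Hl Hl' E Al Al' φ t x π Hx.
  destruct (Bd l Hl) as [β Hβ Bβ], (Bd l' Hl') as [β' Hβ' Bβ'].
  destruct (list_bounded θ (proj1 Ram) (proj1 (proj2 Ram)) [β; β'; c]) as [ζ Hζ Bζ].
  { intros y [<-|[<-|[<-|[]]]]; auto. }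
  destruct (Above ζ (length l) Hζ) as (m & Hm & Lm & Am).
  assert (Om : forall y, In y m -> ordinal y) by (intros y Hy; apply OH, Hm, Hy).
  assert (Bm : forall z y, In z [β; β'; c] -> In y m -> z ∈ y).
  { intros z y Hz Hy; apply (ordinal_trans _ ζ); auto. }
  assert (S1 : same_type c l m).
  { apply Same; auto; apply Join; auto.
    - intros y Hy; apply Bm; simpl; auto.
    - intros y z Hy Hz; apply (ordinal_trans _ β); auto; apply Bm; simpl; auto. }
  assert (S2 : same_type c l' m).
  { apply Same; [|congruence]; apply Join; auto.
    - intros y Hy; apply Bm; simpl; auto.
    - intros y z Hy Hz; apply (ordinal_trans _ β'); auto; apply Bm; simpl; auto. }
  rewrite (S1 φ t x π Hx), (S2 φ t x π Hx); tauto.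
Qed.

End Indiscernibles.

(** * Ordered pairs and sequences *)

Definition upair (x y : V) : V := setof (fun z => z = x \/ z = y).

Lemma mem_upair x y z : z ∈ upair x y <-> z = x \/ z = y.
Proof.
  apply (mem_setof (fun z => z = x \/ z = y)).
  destruct (is_set_range bool (fun b => if b then x else y)) as [a Ha].
  apply (is_set_sub _ a); intros w Hw; apply Ha.
  destruct Hw as [-> | ->]; [now exists true|now exists false].
Qed.

Definition ordered_pair (x y : V) : V := upair (upair x x) (upair x y).

Lemma ordered_pair_inj x y x' y' : ordered_pair x y = ordered_pair x' y' -> x = x' /\ y = y'.
Proof.
  intros E.
  assert (M : forall z, z = upair x x \/ z = upair x y <-> z = upair x' x' \/ z = upair x' y').
  { intros z; rewrite <- !mem_upair; unfold ordered_pair in E; now rewrite E. }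
  assert (U : forall a b c d, upair a b = upair c d -> (a = c \/ a = d) /\ (b = c \/ b = d) /\
    (c = a \/ c = b) /\ (d = a \/ d = b)).
  { intros a b c d F; assert (G : forall z, z = a \/ z = b <-> z = c \/ z = d).
    { intros z; now rewrite <- !mem_upair, F. }
    split; [now apply G; left|split; [now apply G; right|]].
    split; [now apply G; left|now apply G; right]. }
  destruct (proj1 (M _) (or_introl eq_refl)) as [F|F]; apply U in F;
  destruct (proj1 (M _) (or_intror eq_refl)) as [F'|F']; apply U in F';
  destruct (proj2 (M _) (or_intror eq_refl)) as [F''|F'']; apply U in F'';
  intuition congruence.
Qed.

Definition sequence (s : nat -> V) : V := setof (fun z => exists n, z = ordered_pair (num n) (s n)).

Lemma sequence_inj s s' : sequence s = sequence s' -> s = s'.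
Proof.
  assert (M : forall s z, z ∈ sequence s <-> exists n, z = ordered_pair (num n) (s n)).
  { intros u; apply (mem_setof (fun z => exists n, z = ordered_pair (num n) (u n))), is_set_range. }
  intros E; apply functional_extensionality; intros n.
  assert (H : ordered_pair (num n) (s n) ∈ sequence s') by (rewrite <- E; apply M; eauto).
  apply M in H as [m H]; apply ordered_pair_inj in H as [H1 H2]; apply num_inj in H1; now subst.
Qed.

Lemma sort_list Λ s : ordinal Λ -> (forall x, In x s -> x ∈ Λ) ->
  exists l, increasing Λ l /\ forall x, In x l <-> In x s.
Proof.
  intros O; induction s as [|a s IH]; intros Hs.
  - exists []; split; [apply increasing_nil|tauto].
  - destruct IH as (l & Hl & E); [intros; apply Hs; now right|].
    assert (Ha : a ∈ Λ) by (apply Hs; now left).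
    assert (Ins : exists l', increasing Λ l' /\ forall x, In x l' <-> a = x \/ In x l).
    { clear E Hs s; induction l as [|b l IH].
      - exists [a]; split; [|intros; simpl; tauto].
        apply increasing_cons; split; [auto|split; [intros x []|apply increasing_nil]].
      - assert (Hbl := Hl); apply increasing_cons in Hl as (Hb & F & Hl).
        destruct (ordinal_trichotomy a b (ordinal_mem _ _ O Ha) (ordinal_mem _ _ O Hb)) as [L|[<-|L]].
        + exists (a :: b :: l); split; [|intros; simpl; tauto].
          apply increasing_cons; split; [auto|split; auto].
          intros x [<-|Hx]; auto.
          exact (ordinal_trans _ _ _ (ordinal_mem _ _ O (proj2 Hl x Hx)) L (F x Hx)).
        + exists (a :: l); split; auto; intros x; simpl; tauto.
        + destruct (IH Hl) as (l' & Hl' & E); exists (b :: l'); split.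
          * apply increasing_cons; split; [auto|split; auto].
            intros x Hx; apply E in Hx as [<-|Hx]; auto.
          * intros x; simpl; rewrite E; tauto. }
    destruct Ins as (l' & Hl' & E'); exists l'; split; auto.
    intros x; rewrite E', E; simpl; tauto.
Qed.

(** * Extending [R θ] *)

Section Extension.
Context (θ : V) (Ram : ramsey θ) (P : V -> Prop) (Λ : V) (OΛ : ordinal Λ) (Hθ : θ ∈ Λ).
Context (H : V) (Hs : H ⊆ θ) (U : unbounded θ H).

Let A : structure := Structure (R θ) mem P.
Let Oθ : ordinal θ := proj1 (proj1 Ram).
Let Rθ : regular θ := ramsey_regular θ Ram.

Context (Ind : forall c l l', c ∈ H -> increasing H l -> increasing H l' -> length l = length l' ->
    (forall x, In x l -> c ∈ x) -> (forall x, In x l' -> c ∈ x) -> same_type A c l l').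

(** Elements of [R θ] serve as constants.  The ordinals of [Λ] outside of [R θ]
    serve as indices, to be assigned values in [H]; so [Λ] embeds in the ordinals
    of the extension. *)
Definition is_atom (y : V) : Prop := y ∈ R θ \/ y ∈ Λ.

Definition name : Type := {ν : term * (nat -> V) | forall n, is_atom (snd ν n)}.

Definition atom_value (g : V -> V) (y : V) : V :=
  if excluded_middle_informative (y ∈ R θ) then y else g y.

Definition value (ν : name) (g : V -> V) : V :=
  denote A (fst (proj1_sig ν)) (fun n => atom_value g (snd (proj1_sig ν) n)) 0.

Definition assignment (c : V) (s : nat -> V) (g : V -> V) : Prop :=
  forall n, s n ∉ R θ -> g (s n) ∈ H /\ c ∈ g (s n) /\
    forall m, s m ∉ R θ -> s m ∈ s n -> g (s m) ∈ g (s n).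

(** The filter generated by the sets of assignments that map countably many
    indices increasingly into [H], above some bound. *)
Definition almost_all (X : (V -> V) -> Prop) : Prop :=
  exists c s, c ∈ H /\ (forall n, is_atom (s n)) /\ forall g, assignment c s g -> X g.

Let OH x : x ∈ H -> ordinal x.
Proof. intros Hx; exact (ordinal_mem _ _ Oθ (Hs _ Hx)). Qed.

Lemma atom_value_const g y : y ∈ R θ -> atom_value g y = y.
Proof. intros Hy; unfold atom_value; now destruct (excluded_middle_informative (y ∈ R θ)). Qed.

Lemma atom_value_index g y : y ∉ R θ -> atom_value g y = g y.
Proof. intros Hy; unfold atom_value; now destruct (excluded_middle_informative (y ∈ R θ)). Qed.

Lemma above_sequence (b : nat -> V) : (forall n, b n ∈ θ) ->
  exists2 h, h ∈ H & forall n, b n ∈ h.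
Proof.
  intros Hb; destruct (small_bounded θ Rθ (ramsey_num θ Ram 0) nat b) as [γ Hγ B]; auto.
  { now apply small_nat. }
  destruct (U γ Hγ) as [h Hh L]; exists h; auto.
  intros n; exact (ordinal_trans _ _ _ (OH h Hh) (B n) L).
Qed.

Lemma almost_all_mono (X Y : (V -> V) -> Prop) :
  (forall g, X g -> Y g) -> almost_all X -> almost_all Y.
Proof. intros XY (c & s & Hc & Ha & HX); exists c, s; auto. Qed.

Lemma almost_all_inter (X : nat -> (V -> V) -> Prop) :
  (forall n, almost_all (X n)) -> almost_all (fun g => forall n, X n g).
Proof.
  intros HX.
  destruct (choice (fun n (p : V * (nat -> V)) => fst p ∈ H /\ (forall k, is_atom (snd p k)) /\
    forall g, assignment (fst p) (snd p) g -> X n g)) as [p Hp].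
  { intros n; destruct (HX n) as (c & s & Hc); now exists (c, s). }
  destruct (above_sequence (fun n => fst (p n))) as [c Hc B]; [intros n; apply Hs, Hp|].
  exists c, (fun k => snd (p (fst (of_nat k))) (snd (of_nat k))); split; [auto|split].
  - intros k; apply Hp.
  - intros g Hg n; apply Hp.
    assert (E : forall m, snd (p (fst (of_nat (to_nat (n, m))))) (snd (of_nat (to_nat (n, m)))) =
      snd (p n) m) by (intros m; now rewrite cancel_of_to).
    intros m Hm; assert (Hg' := Hg (to_nat (n, m))); cbv beta in Hg'; rewrite E in Hg'.
    destruct (Hg' Hm) as (g1 & g2 & g3); split; [auto|split].
    + exact (ordinal_trans _ _ _ (OH _ g1) (B n) g2).
    + intros k Hk; assert (Hk' := g3 (to_nat (n, k))); cbv beta in Hk'; rewrite E in Hk'; auto.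
Qed.

(** Send each index to an element of [H] above the values of the countably many
    smaller indices; it exists since [θ] is regular and uncountable. *)
Lemma assignment_exists c s : c ∈ H -> exists g, assignment c s g.
Proof.
  intros Hc.
  pose (Q i (f : V -> V) h := h ∈ H /\ c ∈ h /\ forall m, s m ∈ i -> f (s m) ∈ h).
  pose (g := Fix mem_wf (fun _ => V) (fun i rec => epsilon (inhabits c)
    (fun h => h ∈ H /\ c ∈ h /\ forall m (hm : s m ∈ i), rec (s m) hm ∈ h))).
  assert (Eg : forall i, g i = epsilon (inhabits c) (Q i g)).
  { intros i; unfold g at 1; rewrite Fix_eq; [reflexivity|].
    intros u f f' Hf; f_equal; apply functional_extensionality; intros h.
    apply propositional_extensionality; split; intros (h1 & h2 & h3); split; auto; split; auto;
    intros m hm; [rewrite <- Hf|rewrite Hf]; auto. }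
  assert (Hg : forall i, Q i g (g i)).
  { induction i as [i IH] using (well_founded_ind mem_wf); rewrite Eg.
    apply (epsilon_spec (inhabits c) (Q i g)).
    destruct (above_sequence (fun n => match n with 0 => c | S m =>
      if excluded_middle_informative (s m ∈ i) then g (s m) else c end)) as [h Hh B].
    { intros [|m]; auto; destruct (excluded_middle_informative (s m ∈ i)); auto.
      apply Hs; now apply IH. }
    exists h; split; [auto|split; [exact (B 0)|]]; intros m Hm; assert (Bm := B (S m)).
    cbv beta iota in Bm; now destruct (excluded_middle_informative (s m ∈ i)). }
  exists g; intros n _; destruct (Hg (s n)) as (h1 & h2 & h3); split; [auto|split; auto].
Qed.

Lemma almost_all_inhabited X : almost_all X -> exists g, X g.
Proof.
  intros (c & s & Hc & _ & HX); destruct (assignment_exists c s Hc) as [g Hg]; eauto.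
Qed.

(** Only finitely many atoms matter for the truth of a formula, and the indices
    among them are sent by [g] and by [g'] to blocks of indiscernibles above the
    constants. *)
Lemma assignment_homogeneous φ t a c g g' :
  (forall n, is_atom (a n)) -> c ∈ H -> num 0 ∈ R c -> (forall n, a n ∈ R θ -> a n ∈ R c) ->
  assignment c a g -> assignment c a g' ->
  (sat A φ (denote A t (fun n => atom_value g (a n))) <->
   sat A φ (denote A t (fun n => atom_value g' (a n)))).
Proof.
  intros Ha Hc Z Hac Hg Hg'.
  destruct (sat_denote_agree A φ t) as [N HN].
  pose (s := filter (fun y => if excluded_middle_informative (y ∈ R θ) then false else true)
    (map a (seq 0 N))).
  assert (Ms : forall y, In y s <-> y ∉ R θ /\ exists2 n, n < N & y = a n).
  { intros y; unfold s; rewrite filter_In, in_map_iff; split.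
    - intros [(n & <- & Hn) E]; apply in_seq in Hn; split; [|exists n; auto; lia].
      now destruct (excluded_middle_informative (a n ∈ R θ)).
    - intros [Ny [n Hn ->]]; split; [exists n; split; auto; apply in_seq; lia|].
      now destruct (excluded_middle_informative (a n ∈ R θ)). }
  destruct (sort_list Λ s OΛ) as (l & Hl & El).
  { intros y Hy; apply Ms in Hy as [Ny [n _ ->]]; destruct (Ha n); easy. }
  assert (Ml : forall y, In y l -> y ∉ R θ /\ exists n, y = a n).
  { intros y Hy; apply El, Ms in Hy as [Ny [n _ E]]; eauto. }
  destruct (choice (fun n o => (a n ∈ R θ -> o = None) /\ (a n ∉ R θ -> n < N ->
    exists k, o = Some k /\ nth_error l k = Some (a n)))) as [π Hπ].
  { intros n; destruct (classic (a n ∈ R θ)) as [h|h]; [exists None; split; easy|].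
    destruct (Compare_dec.lt_dec n N) as [h'|h']; [|exists None; split; easy].
    assert (I : In (a n) l) by (apply El, Ms; split; eauto).
    apply In_nth_error in I as [k Hk]; exists (Some k); split; [easy|eauto]. }
  pose (x n := if excluded_middle_informative (a n ∈ R θ) then a n else num 0).
  assert (Mix : forall f n, n < N -> atom_value f (a n) = mix x π (map f l) n).
  { intros f n Hn; destruct (Hπ n) as [π1 π2]; unfold mix.
    destruct (classic (a n ∈ R θ)) as [h|h].
    - rewrite atom_value_const, (π1 h) by auto; unfold x.
      now destruct (excluded_middle_informative (a n ∈ R θ)).
    - rewrite atom_value_index by auto; destruct (π2 h Hn) as (k & -> & Ek); symmetry.
      apply nth_error_nth; now rewrite nth_error_map, Ek. }
  assert (Inc : forall f, assignment c a f -> increasing H (map f l) /\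
    forall y, In y (map f l) -> c ∈ y).
  { intros f Hf; split.
    - clear El Hπ Mix; revert Hl Ml; induction l as [|y l IH]; intros Hl Ml; [apply increasing_nil|].
      apply increasing_cons in Hl as (_ & F & Hl).
      destruct (Ml y) as [Ny [n Ey]]; [now left|].
      apply increasing_cons; split; [rewrite Ey in *; now apply Hf|split].
      + intros z Hz; apply in_map_iff in Hz as (w & <- & Hw).
        destruct (Ml w) as [Nw [m Ew]]; [now right|]; specialize (F w Hw).
        rewrite Ew, Ey in *; now apply Hf.
      + apply IH; auto; intros w Hw; apply Ml; now right.
    - intros y Hy; apply in_map_iff in Hy as (w & <- & Hw); destruct (Ml w Hw) as [Nw [m ->]].
      now apply Hf. }
  rewrite (HN _ _ (Mix g)), (HN _ _ (Mix g')).
  destruct (Inc g Hg), (Inc g' Hg'); apply (Ind c); auto.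
  - now rewrite !length_map.
  - intros n; unfold x; destruct (excluded_middle_informative (a n ∈ R θ)); auto.
Qed.

Lemma names_tuple (ν : nat -> name) m : exists t a, (forall n, is_atom (a n)) /\
  (forall k, exists j n, a k = snd (proj1_sig (ν j)) n) /\
  forall g n, n < m -> denote A t (fun k => atom_value g (a k)) n = value (ν n) g.
Proof.
  exists (tuple (fun j => fst (proj1_sig (ν j))) 0 m),
    (fun k => snd (proj1_sig (ν (fst (of_nat k)))) (snd (of_nat k))); split; [|split].
  - intros n; exact (proj2_sig (ν _) _).
  - intros k; eauto.
  - intros g n Hn; rewrite denote_tuple by auto; unfold value; cbv beta; change (0 + n) with n.
    f_equal; apply functional_extensionality; intros k; now rewrite cancel_of_to.
Qed.

Lemma bounding_level (a : nat -> V) :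
  exists c, c ∈ H /\ num 0 ∈ R c /\ forall n, a n ∈ R θ -> a n ∈ R c.
Proof.
  destruct (above_sequence (fun n => match n with 0 => num 0 | S m =>
    if excluded_middle_informative (a m ∈ R θ) then rank (a m) else num 0 end)) as [c Hc B].
  { intros [|m]; [apply (ramsey_num θ Ram 0)|].
    destruct (excluded_middle_informative (a m ∈ R θ)); [now apply mem_R|apply (ramsey_num θ Ram 0)]. }
  exists c; split; [auto|split].
  - apply ordinal_in_R; auto; exact (B 0).
  - intros n Hn; apply mem_R; assert (Bn := B (S n)); cbv beta iota in Bn.
    now destruct (excluded_middle_informative (a n ∈ R θ)).
Qed.

Lemma value_decided φ (ν : nat -> name) :
  almost_all (fun g => sat A φ (fun n => value (ν n) g)) \/
  almost_all (fun g => ~ sat A φ (fun n => value (ν n) g)).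
Proof.
  destruct (names_tuple ν (bound φ)) as (t & a & Ha & _ & E).
  destruct (bounding_level a) as (c & Hc & Z & Hac).
  assert (Eq : forall g, sat A φ (denote A t (fun k => atom_value g (a k))) <->
    sat A φ (fun n => value (ν n) g)) by (intros g; apply sat_agree, E).
  destruct (classic (exists g, assignment c a g /\ sat A φ (fun n => value (ν n) g)))
    as [(g & Hg & S)|N].
  - left; exists c, a; split; [auto|split; auto]; intros g' Hg'.
    apply Eq; apply Eq in S; revert S; apply (assignment_homogeneous φ t a c); auto.
  - right; exists c, a; split; [auto|split; auto]; intros g' Hg' S; apply N; eauto.
Qed.

Lemma value_dom ν : almost_all (fun g => value ν g ∈ dom A).
Proof.
  destruct ν as [[t a] Ha]; destruct (U _ (ramsey_num θ Ram 0)) as [c Hc _].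
  exists c, a; split; [auto|split; [exact Ha|]]; intros g Hg; unfold value; simpl.
  apply (denote_dom A); [apply ordinal_in_R; auto; apply (ramsey_num θ Ram 0)|].
  intros n; destruct (classic (a n ∈ R θ)) as [h|h].
  - now rewrite atom_value_const.
  - rewrite atom_value_index by auto; apply ordinal_in_R; auto; now apply Hs, Hg.
Qed.

Definition atom_name (y : V) (Hy : is_atom y) : name :=
  exist (fun ν => forall n, is_atom (snd ν n)) (tId, fun _ => y) (fun _ => Hy).

Lemma value_atom_name y Hy g : value (atom_name y Hy) g = atom_value g y.
Proof. reflexivity. Qed.

Lemma value_const x : x ∈ dom A -> exists ν, forall g, value ν g = x.
Proof.
  intros Hx; exists (atom_name x (or_introl Hx)); intros g.
  rewrite value_atom_name; now apply atom_value_const.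
Qed.

Lemma value_skolem φ (ν : nat -> name) : exists σ, almost_all (fun g =>
  ~ sat A (fAll φ) (fun n => value (ν n) g) -> ~ sat A φ (scons (value σ g) (fun n => value (ν n) g))).
Proof.
  destruct (names_tuple ν (bound φ)) as (t & a & Ha & _ & E).
  exists (exist (fun ν => forall n, is_atom (snd ν n)) (tSkolem φ t, a) Ha).
  destruct (U _ (ramsey_num θ Ram 0)) as [c Hc _].
  exists c, a; split; [auto|split; [exact Ha|]]; intros g _; unfold value at 2; simpl fst; simpl snd.
  cbn [denote]; set (v := denote A t (fun n => atom_value g (a n))).
  assert (Ev : forall n, n < bound φ -> v n = value (ν n) g) by apply E.
  rewrite <- (sat_agree A (fAll φ) v) by (simpl; intros; apply Ev; lia).
  rewrite <- (sat_agree A φ (scons (skolem A φ v) v)).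
  - apply skolemP; apply ordinal_in_R; auto; apply (ramsey_num θ Ram 0).
  - intros [|n] Hn; simpl; auto; apply Ev; lia.
Qed.

(** If two assignments are above the bound [x], the values of the name have the
    same type over [x], and these values are in [x]; so they are equal. *)
Lemma value_regressive ν x : x ∈ dom A -> almost_all (fun g => value ν g ∈ x) ->
  exists2 y, y ∈ dom A & almost_all (fun g => value ν g = y).
Proof.
  intros Hx HD; destruct ν as [[t a] Ha]; set (ν := exist _ _ _) in *.
  destruct (bounding_level (fun n => match n with 0 => x | S m => a m end)) as (c & Hc & Z & Hac).
  assert (Hxc : x ∈ R c) by exact (Hac 0 Hx).
  assert (HB : almost_all (assignment c a)) by (exists c, a; auto).
  destruct (almost_all_inhabited (fun g => forall n, match n with 0 => value ν g ∈ x | _ => assignment c a g end))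
    as [g0 Hg0].
  { apply (almost_all_inter (fun n g => match n with 0 => value ν g ∈ x | _ => assignment c a g end)).
    intros [|n]; auto. }
  assert (G1 := Hg0 0); assert (G2 := Hg0 1); cbv beta iota in G1, G2.
  set (y := value ν g0) in *.
  assert (Hyc : y ∈ R c) by (apply (R_transitive _ y x); auto).
  assert (Hy : y ∈ R θ) by (apply (R_mono c); auto).
  exists y; auto.
  destruct (names_tuple (fun n => match n with 0 => ν | _ => atom_name y (or_introl Hy) end) 2)
    as (u & b & Hb & Rb & Eb).
  assert (Ab : forall g, assignment c a g -> assignment c b g).
  { assert (Bb : forall k, b k ∉ R θ -> exists n, b k = a n).
    { intros k Nk; destruct (Rb k) as ([|j] & n & E); [exists n; exact E|]; simpl in E.
      now rewrite E in Nk. }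
    intros g Hg n Hn; destruct (Bb n Hn) as [n' En]; rewrite En in *.
    destruct (Hg n' Hn) as (g1 & g2 & g3); split; [auto|split; auto].
    intros m Hm; destruct (Bb m Hm) as [m' Em]; rewrite Em in *; auto. }
  exists c, b; split; [auto|split; [auto|]]; intros g Hg.
  assert (V1 : forall f, value (atom_name y (or_introl Hy)) f = y).
  { intros f; rewrite value_atom_name; now apply atom_value_const. }
  assert (S : sat A (fEq 0 1) (denote A u (fun k => atom_value g (b k)))).
  { apply (assignment_homogeneous (fEq 0 1) u b c g g0); auto.
    - intros k Hk; destruct (Rb k) as ([|j] & n & E); rewrite E in *; simpl in *; auto.
      exact (Hac (S n) Hk).
    - simpl; rewrite !Eb by lia; now rewrite V1. }
  simpl in S; rewrite !Eb in S by lia; now rewrite V1 in S.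
Qed.

(** The first component keeps the codes out of [R θ]. *)
Definition encode (ν : name) : V :=
  ordered_pair (R θ) (sequence (fun n => match n with
    0 => num (code_term (fst (proj1_sig ν))) | S m => snd (proj1_sig ν) m end)).

Lemma encode_inj ν μ : encode ν = encode μ -> ν = μ.
Proof.
  destruct ν as [[t a] Ha], μ as [[u b] Hb]; intros E; apply ordered_pair_inj in E as [_ E].
  apply sequence_inj in E; simpl in E.
  assert (t = u) as <-.
  { apply code_term_inj, num_inj; exact (f_equal (fun s => s 0) E). }
  assert (a = b) as <-.
  { apply functional_extensionality; intros n; exact (f_equal (fun s => s (S n)) E). }
  f_equal; apply proof_irrelevance.
Qed.

Lemma encode_dom ν : encode ν ∉ dom A.
Proof.
  intros Hν; simpl in Hν.
  assert (H1 : upair (R θ) (R θ) ∈ R θ).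
  { apply (R_transitive _ _ _ Oθ) with (2 := Hν); apply mem_upair; auto. }
  apply (mem_irrefl (R θ)); apply (R_transitive _ _ _ Oθ) with (2 := H1); apply mem_upair; auto.
Qed.

Lemma encode_set : is_set (fun x => exists ν, x = encode ν).
Proof.
  destruct (set_enum (R θ)) as (B1 & F1 & H1), (set_enum Λ) as (B2 & F2 & H2).
  pose (F (b : B1 + B2) := cls (match b with inl b => F1 b | inr b => F2 b end)).
  destruct (is_set_range (term * (nat -> B1 + B2)) (fun p =>
    ordered_pair (R θ) (sequence (fun n => match n with
      0 => num (code_term (fst p)) | S m => F (snd p m) end)))) as [c Hc].
  apply (is_set_sub _ c); intros x [[[t a] Ha] ->]; apply Hc.
  destruct (choice (fun n b => a n = F b)) as [b Hb].
  { intros n; destruct (Ha n) as [h|h].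
    - apply H1 in h as [i E]; now exists (inl i).
    - apply H2 in h as [i E]; now exists (inr i). }
  exists (t, b); unfold encode; simpl; do 2 f_equal.
  apply functional_extensionality; intros [|n]; auto.
Qed.

Definition extension : structure := limited_ultrapower A _ name almost_all value encode.

Notation point := (point A _ name almost_all value encode).

Lemma extension_los φ (ν : nat -> name) :
  sat extension φ (fun n => point (ν n)) <-> almost_all (fun g => sat A φ (fun n => value (ν n) g)).
Proof.
  exact (los A _ name almost_all value almost_all_mono almost_all_inter almost_all_inhabited
    value_dom value_decided value_skolem encode encode_inj encode_dom encode_set φ ν).
Qed.

Lemma extension_wf : wellfounded_structure extension.
Proof.
  exact (limited_ultrapower_wf A _ name almost_all value almost_all_mono almost_all_inter
    almost_all_inhabited value_dom value_decided value_skolem encode encode_inj encode_dom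
    encode_set mem_wf).
Qed.

Lemma point_in_extension ν : point ν ∈ dom extension.
Proof.
  apply (mem_points A _ name almost_all value encode encode_set); eauto.
Qed.

Lemma extension_end : end_elementary_extension A extension.
Proof.
  apply (limited_ultrapower_end A _ name almost_all value almost_all_mono almost_all_inter
    almost_all_inhabited value_dom value_const value_decided value_skolem encode encode_inj
    encode_dom encode_set value_regressive).
  exists (atom_name θ (or_intror Hθ)).
  destruct (pointP A _ name almost_all value encode (atom_name θ (or_intror Hθ))) as [[Hx HD]|[_ E]].
  2:{ rewrite E; apply encode_dom. }
  intros _; set (x := point _) in *.
  assert (Nθ : θ ∉ R θ).
  { intros Hn; apply (mem_irrefl θ); exact (ordinal_in_R_inv θ θ Oθ Hn). }
  destruct (bounding_level (fun _ => x)) as (c & Hc & _ & Hxc).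
  specialize (Hxc 0 Hx); apply mem_R in Hxc.
  assert (HB : almost_all (assignment c (fun _ => θ))).
  { exists c, (fun _ => θ); split; [auto|split; auto]; intros _; now right. }
  destruct (almost_all_inhabited (fun g => forall n, match n with
    0 => value (atom_name θ (or_intror Hθ)) g = x | _ => assignment c (fun _ => θ) g end)) as [g Hg].
  { apply (almost_all_inter (fun n g => match n with
      0 => value (atom_name θ (or_intror Hθ)) g = x | _ => assignment c (fun _ => θ) g end)).
    intros [|n]; auto. }
  assert (G1 := Hg 0); assert (G2 := Hg 1 0 Nθ); cbv beta iota in G1, G2.
  rewrite value_atom_name, atom_value_index in G1 by auto.
  destruct G2 as (g1 & g2 & _); rewrite <- G1, rank_ordinal in Hxc by auto.
  exact (mem_asym _ _ Hxc g2).
Qed.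

Lemma extension_height : exists2 β, ordinal_height extension β & Λ ⊆ β.
Proof.
  assert (Oi : forall i, i ∈ Λ -> ordinal i) by (intros i; apply ordinal_mem, OΛ).
  destruct (ordinal_height_exists θ P extension Oθ (ramsey_num θ Ram 0)
    (proj1 extension_end) extension_wf) as [β Hβ Sup].
  exists β; auto.
  destruct (choice (fun i y => forall h : i ∈ Λ, y = point (atom_name i (or_intror h)))) as [e He].
  { intros i; destruct (classic (i ∈ Λ)) as [h|h]; [|now exists i].
    exists (point (atom_name i (or_intror h))); intros h'; do 2 f_equal; apply proof_irrelevance. }
  apply (Sup Λ e OΛ).
  - intros i Hi; rewrite (He i Hi); set (ν := atom_name i _).
    apply (sat_fOrdinal extension 0 (fun _ => point ν)); [apply point_in_extension|].
    apply (extension_los (fOrdinal 0) (fun _ => ν)).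
    destruct (U _ (ramsey_num θ Ram 0)) as [c Hc _].
    exists c, (fun _ => i); split; [auto|split; [intros _; now right|]]; intros g Hg.
    assert (V1 : value ν g ∈ R θ /\ ordinal (value ν g)).
    { unfold ν; rewrite value_atom_name; destruct (classic (i ∈ R θ)) as [h|h].
      - rewrite atom_value_const by auto; auto.
      - rewrite atom_value_index by auto; destruct (Hg 0 h) as (g1 & _); split; auto.
        apply ordinal_in_R; auto. }
    apply (sat_fOrdinal A 0); [apply V1|]; now apply ordinal_in_R_iff.
  - intros i j Hi Hj L; rewrite (He i Hi), (He j Hj).
    set (ν := atom_name i _); set (μ := atom_name j _).
    apply (extension_los (fRel 0 1) (fun n => match n with 0 => ν | _ => μ end)); simpl.
    pose (s n := match n with 0 => i | _ => j end).
    destruct (bounding_level s) as (c & Hc & _ & Hsc).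
    exists c, s; split; [auto|split; [intros [|n]; now right|]]; intros g Hg.
    unfold ν, μ; rewrite !value_atom_name.
    destruct (classic (j ∈ R θ)) as [hj|hj].
    + rewrite !atom_value_const; auto; exact (R_transitive _ _ _ Oθ L hj).
    + rewrite (atom_value_index g j hj); destruct (Hg 1 hj) as (g1 & g2 & g3).
      destruct (classic (i ∈ R θ)) as [hi|hi].
      * rewrite atom_value_const by auto; simpl in g1, g2.
        apply (ordinal_trans _ c); auto; apply ordinal_in_R_inv; auto; exact (Hsc 0 hi).
      * rewrite atom_value_index by auto; exact (g3 0 hi L).
Qed.

End Extension.

Lemma ramsey_extension θ α S : ramsey θ -> ordinal α -> exists M,
  wellfounded_structure M /\ end_elementary_extension (Structure (R θ) mem (elts S)) M /\
  exists2 β, ordinal_height M β & α ⊆ β.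
Proof.
  intros Ram Oα; assert (Oθ := proj1 (proj1 Ram)).
  assert (HΛ : exists Λ, ordinal Λ /\ θ ∈ Λ /\ α ⊆ Λ).
  { assert (Os := ordinal_succ θ Oθ); assert (Hs : θ ∈ succ θ) by (apply mem_succ; auto).
    destruct (ordinal_trichotomy α (succ θ) Oα Os) as [L|[->|L]].
    - exists (succ θ); split; [auto|split; auto]; exact (proj1 Os α L).
    - exists (succ θ); split; [auto|split; auto]; intros x Hx; exact Hx.
    - exists α; split; [auto|split; [exact (ordinal_trans _ _ _ Oα Hs L)|intros x Hx; exact Hx]]. }
  destruct HΛ as (Λ & OΛ & Hθ & Hα).
  destruct (indiscernibles θ Ram (Structure (R θ) mem (elts S))) as (H & Hs & U & Ind).
  exists (extension θ (elts S) Λ H); split; [|split].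
  - now apply extension_wf.
  - now apply extension_end.
  - destruct (extension_height θ Ram (elts S) Λ OΛ Hθ H Hs U Ind) as [β Hβ Sub]; exists β; auto.
    intros x Hx; auto.
Qed.

Theorem theorem3p4 (κ θ : V) (hκ : first unfoldable κ) (hθ : first ramsey θ) :
  κ ∈ θ.
Proof.
  destruct hκ as [[Iκ _] Min], hθ as [Ram _].
  assert (Oκ := proj1 (proj1 Iκ)); assert (Oθ := proj1 (proj1 Ram)).
  apply NNPP; intros N.
  assert (NU : forall μ, μ ∈ θ -> ~ unfoldable μ).
  { intros μ Hμ; apply Min; exact (ordinal_mem_not_mem θ κ μ Oθ Oκ N Hμ). }
  destruct (choice (fun μ (p : V * V) => μ ∈ θ -> inaccessible μ -> ordinal (fst p) /\
    ~ exists M, wellfounded_structure M /\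
      end_elementary_extension (Structure (R μ) mem (elts (snd p))) M /\
      exists2 β, ordinal_height M β & fst p ⊆ β)) as [p Hp].
  { intros μ; destruct (classic (μ ∈ θ /\ inaccessible μ)) as [[Hμ Iμ]|h]; [|exists (μ, μ); tauto].
    apply NNPP; intros N'; apply (NU μ Hμ); split; auto; intros α S Oα HS.
    apply NNPP; intros N''; apply N'; now exists (α, S). }
  destruct (ramsey_reflection θ Ram (fun μ => snd (p μ))) as (γ & S & Hγ & Iγ & El).
  destruct (Hp γ Hγ Iγ) as [Oα Bad]; apply Bad.
  destruct (ramsey_extension θ (fst (p γ)) S Ram Oα) as (M & Wf & [[Sub ElM] [Ne End]] & Ht).
  simpl in Sub, Ne, End.
  assert (Rγ : R γ ⊆ R θ) by now apply R_mono.
  exists M; split; [auto|split; [|auto]]; split; [split|split].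
  - intros x Hx; apply Sub, Rγ, Hx.
  - intros φ v Hv; etransitivity; [apply (El φ v Hv)|apply ElM].
    intros n; apply Rγ, Hv.
  - simpl; intros E; apply (mem_irrefl γ), (ordinal_in_R_inv γ); [exact (ordinal_mem _ _ Oθ Hγ)|].
    rewrite E; apply Sub, ordinal_in_R; auto.
  - simpl; intros a Ha b; rewrite <- End by auto; split; intros [Hb L]; split; auto.
    exact (R_transitive _ _ _ (ordinal_mem _ _ Oθ Hγ) L Ha).
Qed.
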